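(* Let $\mathbb I=[0,1]$ and let $\mathcal M$ be the ideal of meager subsets of the Hilbert cube $\mathbb I^\omega$. For $n,m\le\omega$ let $\mathcal Z_n$ be the family of $Z_n$-sets in $\mathbb I^\omega$ and $\overline{\mathcal D}_m$ the family of closed subsets $A\subseteq\mathbb I^\omega$ of topological dimension $\dim(A)\le m$. Then for every $n,m\le\omega$ the $\sigma$-ideal $\mathcal I=\sigma(\mathcal Z_n\cap\overline{\mathcal D}_m)$ generated by the family $\mathcal Z_n\cap\overline{\mathcal D}_m$ is a $\sigma^{( * )}$-ideal on $\mathbb I^\omega$ with cardinal characteristics $\mathrm{add}(\mathcal I)=\mathrm{add}(\mathcal M)$, $\mathrm{cov}(\mathcal I)=\mathrm{cov}(\mathcal M)$, $\mathrm{non}(\mathcal I)=\mathrm{non}(\mathcal M)$, $\mathrm{cof}(\mathcal I)=\mathrm{cof}(\mathcal M)$.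
   Context: For $n\le\omega$, a closed subset $A$ of a topological space $X$ is a $Z_n$-set in $X$ if $\{f\in C(\mathbb I^n,X):f(\mathbb I^n)\cap A=\emptyset\}$ is dense in the space $C(\mathbb I^n,X)$ of continuous functions with the compact-open topology. For $m=\omega$ the condition $\dim(A)\le m$ is vacuous, i.e. $\overline{\mathcal D}_\omega$ is the family of all closed subsets of $\mathbb I^\omega$. The $\sigma$-ideal generated by a family $\mathcal F$ consists of all subsets of countable unions of sets from $\mathcal F$. An ideal on a set is a non-empty family of subsets closed under subsets and finite unions. For a compact space $X$, $\mathcal K(X)$ is the family of all compact subsets of $X$ with the Vietoris topology; for $G\subseteq X$, $\mathcal K(G)$ is the family of compact subsets of $G$. An ideal $\mathcal I$ on $X$ is a $G_\delta$-ideal if $\mathcal I\cap\mathcal K(X)$ is a $G_\delta$-set in $\mathcal K(X)$. It has the Solecki property $( * )$ if for any countable family $\mathcal A\subseteq\mathcal I\cap\mathcal K(X)$ the union $\bigcup\mathcal A$ is contained in a $G_\delta$-subset $G\subseteq X$ with $\mathcal K(G)\subseteq\mathcal I$. It is a $\sigma^{( * )}$-ideal if there is a sequence $(\mathcal I_n)_{n\in\omega}$ of $G_\delta$-ideals with the Solecki property $( * )$ on $X$ such that $\mathcal I=\{A\subseteq X: A\subseteq\bigcup\mathcal A$ for some countable subfamily $\mathcal A\subseteq\bigcup_{n\in\omega}(\mathcal I_n\cap\mathcal K(X))\}$. For an ideal $\mathcal I$ on a set $X=\bigcup\mathcal I\notin\mathcal I$: $\mathrm{add}(\mathcal I)=\min\{|\mathcal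 A|:\mathcal A\subseteq\mathcal I,\ \bigcup\mathcal A\notin\mathcal I\}$, $\mathrm{non}(\mathcal I)=\min\{|A|:A\subseteq X,\ A\notin\mathcal I\}$, $\mathrm{cov}(\mathcal I)=\min\{|\mathcal A|:\mathcal A\subseteq\mathcal I,\ \bigcup\mathcal A=X\}$, $\mathrm{cof}(\mathcal I)=\min\{|\mathcal A|:\mathcal A\subseteq\mathcal I,\ \forall B\in\mathcal I\ \exists A\in\mathcal A\ (B\subseteq A)\}$. *)

(* Defs.v *)
From HB Require Import structures.
From mathcomp Require Import all_boot all_order all_algebra.
From mathcomp Require Import all_classical all_reals all_analysis.
From mathcomp Require Import borel_hierarchy.

Set Implicit Arguments.
Unset Strict Implicit.
Unset Printing Implicit Defensive.

Import Order.TTheory GRing.Theory Num.Theory.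
Import numFieldNormedType.Exports.

Local Open Scope classical_set_scope.
Local Open Scope card_scope.
Local Open Scope ring_scope.

(** Ordinals at most omega. *)
Variant le_omega := Fin of nat | Omega.

Definition cube_index (n : le_omega) : countType :=
  match n with Fin k => 'I_k | Omega => nat end.

Definition unit_interval (R : realType) : set R := `[0, 1].

Notation cube R n :=
  (prod_topology (fun _ : cube_index n => set_type (@unit_interval R))).

Definition hilbert_cube (R : realType) : topologicalType := cube R Omega.

Definition cont_space (U V : topologicalType) : Type := continuousType U V.

HB.instance Definition _ (U V : topologicalType) :=
  Choice.copy (cont_space U V) (continuousType U V).
HB.instance Definition _ (U V : topologicalType) :=
  Topological.copy (cont_space U V)
    (@initial_topology (cont_space U V) {compact-open, U -> V} (fun f => f)).

Definition Zset (R : realType) (X : topologicalType) (n : le_omega) :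
    set (set X) :=
  [set A | closed A /\
    dense [set f : cont_space (cube R n) X | range f `&` A = set0]].

Definition open_cover (T : topologicalType) (C : set (set T)) : Prop :=
  C `<=` open /\ \bigcup_(U in C) U = setT.

Definition refines (T : Type) (D C : set (set T)) : Prop :=
  forall V, D V -> exists2 U, C U & V `<=` U.

(** The order condition says that at most [n + 1] members of [D] contain any
    given point; the empty space, of dimension [-1], satisfies it for all [n]. *)
Definition covering_dim_le (T : topologicalType) (n : nat) : Prop :=
  forall C : set (set T), finite_set C -> open_cover C ->
    exists D : set (set T),
      [/\ finite_set D, open_cover D, refines D C &
          forall x : T, [set V | D V /\ V x] #<= `I_n.+1].

Definition dim_le (T : topologicalType) (m : le_omega) : Prop :=
  match m with Fin k => covering_dim_le T k | Omega => True end.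

(** [set_type A] carries the subspace topology. *)
Definition closed_dim_le (X : topologicalType) (m : le_omega) : set (set X) :=
  [set A | closed A /\ dim_le (set_type A) m].

Definition sigma_generated (T : Type) (F : set (set T)) : set (set T) :=
  [set A | exists2 C : set (set T),
    countable C /\ C `<=` F & A `<=` \bigcup_(B in C) B].

Definition nowhere_dense (X : topologicalType) : set (set X) :=
  [set A | interior (closure A) = set0].

Definition meager (X : topologicalType) : set (set X) :=
  sigma_generated (@nowhere_dense X).

(** [K(X)]; the empty set is one of its (isolated) points. *)
Definition hyperspace (X : topologicalType) : Type := {K : set X | compact K}.

HB.instance Definition _ (X : topologicalType) := gen_eqMixin (hyperspace X).
HB.instance Definition _ (X : topologicalType) :=
  gen_choiceMixin (hyperspace X).

Definition vietoris_subbase (X : topologicalType) : set (set (hyperspace X)) :=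
  [set [set K : hyperspace X | sval K `<=` U] | U in open] `|`
  [set [set K : hyperspace X | sval K `&` U !=set0] | U in open].

HB.instance Definition _ (X : topologicalType) :=
  isSubBaseTopological.Build (hyperspace X) (@vietoris_subbase X) id.

Definition ideal (T : Type) (J : set (set T)) : Prop :=
  [/\ J !=set0,
      forall A B, B `<=` A -> J A -> J B &
      forall A B, J A -> J B -> J (A `|` B)].

Definition Gdelta_ideal (X : topologicalType) (J : set (set X)) : Prop :=
  ideal J /\ Gdelta [set K : hyperspace X | J (sval K)].

Definition solecki (X : topologicalType) (J : set (set X)) : Prop :=
  forall C : set (set X), countable C -> C `<=` J `&` @compact X ->
    exists G : set X,
      [/\ Gdelta G, \bigcup_(A in C) A `<=` G &
          forall K, compact K -> K `<=` G -> J K].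

Definition sigma_star_ideal (X : topologicalType) (J : set (set X)) : Prop :=
  ideal J /\
  exists2 Jn : nat -> set (set X),
    forall n, Gdelta_ideal (Jn n) /\ solecki (Jn n) &
    J = sigma_generated (\bigcup_n (Jn n `&` @compact X)).

(** Cardinals are represented by sets up to equinumerosity: the predicates below
    say that the cardinality of [k] is the minimum in question, and in
    particular that this minimum exists. *)

Definition is_min_card (T : Type) (F : set (set T)) (k : set T) : Prop :=
  (exists2 A, F A & A #= k) /\ forall A, F A -> k #<= A.

Definition is_add (T : Type) (J : set (set T)) (k : set (set T)) : Prop :=
  is_min_card [set C | C `<=` J /\ ~ J (\bigcup_(A in C) A)] k.

Definition is_cov (T : Type) (J : set (set T)) (k : set (set T)) : Prop :=
  is_min_card [set C | C `<=` J /\ \bigcup_(A in C) A = setT] k.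

Definition is_non (T : Type) (J : set (set T)) (k : set T) : Prop :=
  is_min_card [set A | ~ J A] k.

Definition is_cof (T : Type) (J : set (set T)) (k : set (set T)) : Prop :=
  is_min_card
    [set C | C `<=` J /\ forall B, J B -> exists2 A, C A & B `<=` A] k.

(* Main.v *)
(* Every ideal in sight is given by a countable poset of conditions carrying
   open regions: a closed set is in the generating family when below each
   condition there is one whose region misses it. The Z_n-sets arise from
   basic open sets of the function space C(I^n, X), the sets of dimension at
   most m from the Eilenberg-Otto criterion (m + 1 pairs of open sets with
   disjoint closures extend to pairs covering the set), the nowhere dense sets
   from a base of X. This representation yields the G_delta and Solecki
   properties by compactness. When moreover each condition has infinitely many
   conditions below it with disjoint regions, and the sets in question are
   nowhere dense, the cardinal characteristics are those of four combinatorial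
   families in omega^omega. A map X -> omega^omega turns eventually different
   functions into members of the ideal; conversely, by Bartoszynski's theorem,
   two successive infinitely often equal functions give a generic binary
   sequence, which codes both a point outside a given member of the ideal and,
   with the help of a dominating function, a sigma-compact member containing a
   given one; finally, compact sets built along a tree of finite nets convert
   a bound in the ideal into a bound for functions. Hence any two ideals of
   this kind on X, in particular the given one and the meager ideal, share all
   four characteristics. *)

Require Import Defs.
From HB Require Import structures.
From mathcomp Require Import all_boot all_order all_algebra finmap ring lra.
From mathcomp Require Import all_classical all_reals all_analysis.

Set Implicit Arguments.
Unset Strict Implicit.
Unset Printing Implicit Defensive.

Import Order.TTheory GRing.Theory Num.Theory.
Import numFieldNormedType.Exports.

Local Open Scope classical_set_scope.
Local Open Scope card_scope.
Local Open Scope nat_scope.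

(** * Cardinals of sets *)

(** The classical formulas add(M) = min(b, cov(M)) and cof(M) = max(d, non(M)) shape the interface
    [governed]. A generic sequence takes two infinitely often equal functions because the lengths of
    the words must be settled before the words can be guessed. Domination enters for additivity and
    cofinality: a generic sequence meets the n-th dense set after some finite length, and only a
    dominating function bounds these lengths for almost all n at once. Unbounded families of
    functions must be encoded by members of every ideal concerned, however thin, hence by
    intersections of shrinking neighbourhoods of finite sets. Since one member of a new family is
    made from two or three members of an old one, the square of an infinite cardinal has to be
    computed. *)

Lemma card_le_relP (T U : Type) (A : set T) (B : set U) :
  (A #<= B) <-> exists R : T -> U -> Prop,
    (forall x, A x -> exists2 y, B y & R x y) /\
    (forall x x' y, A x -> A x' -> R x y -> R x' y -> x = x').
Proof.
split=> [/card_leP[f]|[R [Rt Ri]]].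
  exists (fun x y => exists2 a : A, val a = x & val (f a) = y); split.
    move=> x Ax; pose a : A := SigSub (mem_set Ax).
    by exists (val (f a)); [exact: (set_valP (f a))|exists a].
  move=> x x' y _ _ [a <- <-] [a' <-] /val_inj/(@inj _ _ _ f a' a).
  by rewrite !inE => /(_ I I) ->.
apply/card_leP.
have /choice[f fP] (a : A) : exists b : B, R (val a) (val b).
  have [y By Rxy] := Rt _ (set_valP a).
  by exists (SigSub (mem_set By)).
apply/injfunPex; exists f => // a a' _ _ ff; apply: val_inj.
apply: (Ri _ _ (val (f a))); [exact: set_valP|exact: set_valP|exact: fP|].
by rewrite ff; exact: fP.
Qed.

Lemma card_le_inj (T U : Type) (A : set T) (B : set U) (f : T -> U) :
  (forall x, A x -> B (f x)) ->
  (forall x x', A x -> A x' -> f x = f x' -> x = x') -> A #<= B.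
Proof.
move=> fAB finj; apply/card_le_relP; exists (fun x y => f x = y); split.
  by move=> x /fAB Bfx; exists (f x).
by move=> x x' y Ax Ax' <- /esym; exact: finj.
Qed.

Lemma card_le_fun (T : Type) (A B : set T) : A #<= B ->
  exists f : T -> T, (forall x, A x -> B (f x)) /\
    (forall x x', A x -> A x' -> f x = f x' -> x = x').
Proof.
move=> /card_le_relP[R [Rt Ri]].
have /choice[f fP] (x : T) : exists y, A x -> B y /\ R x y.
  have [Ax|nAx] := pselect (A x); last by exists x.
  by have [y By Rxy] := Rt _ Ax; exists y.
exists f; split=> [x /fP[]//|x x' Ax Ax' ff].
by apply: (Ri _ _ (f x)) => //; [case: (fP x)|rewrite ff; case: (fP x')].
Qed.

(* A maximal set of choice functions for [F] that differ pairwise on every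
   member of [F] has to exhaust some member of [F]. *)
Lemma exists_min_card (T : Type) (F : set (set T)) : F !=set0 ->
  exists k, is_min_card F k.
Proof.
move=> [A0 FA0].
pose P (M : set (set T -> T)) := forall m, M m ->
  (forall A, F A -> A (m A)) /\
  (forall m', M m' -> forall A, F A -> m A = m' A -> m = m').
have [|M [PM Mmax]] := @Zorn_bigcup _ P.
  move=> G GP Gtot m [M GM Mm]; split; first by case: (GP _ GM _ Mm).
  move=> m' [M' GM' Mm'].
  have [MM'|M'M] := Gtot _ _ GM GM'.
    by have [_] := GP _ GM' _ (MM' _ Mm); apply.
  by have [_] := GP _ GM _ Mm; apply; apply: M'M.
have [k Fk kM] : exists2 k, F k & forall a, k a -> exists2 m, M m & m k = a.
  apply: contrapT => noK.
  have /choice[m mP] (A : set T) : exists a, F A ->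
      A a /\ forall m, M m -> m A <> a.
    have [FA|] := pselect (F A); last first.
      have [[t _] nFA|] := pselect (exists t : T, True); first by exists t.
      move=> noT; exfalso; apply: noK; exists A0 => // a.
      by exfalso; apply: noT; exists a.
    apply: contrapT => noa; apply: noK; exists A => // a Aa.
    apply: contrapT => nom; apply: noa; exists a => _; split=> // m Mm mAa.
    by apply: nom; exists m.
  have mM : ~ M m by move=> Mm; have [_ /(_ _ Mm)] := mP A0 FA0.
  apply: (Mmax (M `|` [set m])).
    by split=> [x Mx|/(_ m) Mm]; [left|apply: mM; apply: Mm; right].
  move=> m' [Mm'|->].
    split; first by case: (PM _ Mm').
    move=> m'' [Mm''|->]; first by have [_] := PM _ Mm'; apply.
    by move=> A FA /(proj2 (mP A FA) _ Mm').
  split; first by move=> A /mP[].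
  by move=> m'' [Mm''|->//] A FA /esym/(proj2 (mP A FA) _ Mm'').
exists k; split=> [|B FB]; first by exists k.
(* Matching the values of each [m] at [k] and at [B] is total because [M] exhausts [k], and
   injective because the members of [M] differ at [B]. *)
apply/card_le_relP; exists (fun a b => exists m, [/\ M m, m k = a & m B = b]).
split=> [a /kM[m Mm <-]|a a' b _ _ [m [Mm <- mB]] [m' [Mm' <- m'B]]].
  by exists (m B); [case: (PM _ Mm) => + _; apply|exists m].
by have [_ /(_ _ Mm' _ FB) ->//] := PM _ Mm; rewrite mB m'B.
Qed.

Lemma is_min_card_transfer (T : Type) (F G : set (set T)) : F !=set0 ->
  (forall A, F A -> exists2 B, G B & B #<= A) ->
  (forall B, G B -> exists2 A, F A & A #<= B) ->
  exists2 k, is_min_card F k & is_min_card G k.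
Proof.
move=> F0 FG GF; have [k kF] := exists_min_card F0; exists k => //.
have [[A FA Ak] kmin] := kF; split=> [|B /GF[A' /kmin kA' A'B]].
  have [B GB BA] := FG _ FA; exists B => //.
  rewrite card_eq_le (card_le_trans BA) ?card_eq_le//=.
    by have [A' /kmin kA' A'B] := GF _ GB; exact: (card_le_trans kA').
  by move: Ak; rewrite card_eq_le => /andP[].
exact: card_le_trans A'B.
Qed.

Lemma card_le_total (T : Type) (A B : set T) : A #<= B \/ B #<= A.
Proof.
have [|k [[k' [->|->] k'k] kmin]] := @exists_min_card _ [set A; B].
- by exists A; left.
- left; have /card_le_trans : A #<= k by move: k'k;
  rewrite card_eq_le => /andP[].
  by apply; apply: kmin; right.
- right; have /card_le_trans : B #<= k by move: k'k;
  rewrite card_eq_le => /andP[].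
  by apply; apply: kmin; left.
Qed.

Lemma infinite_seq_inj (T : Type) (A : set T) : infinite_set A ->
  exists e : nat -> T, (forall n, A (e n)) /\ injective e.
Proof.
move=> /infiniteP/card_le_relP[R [Rt Ri]].
have /choice[e eP] (n : nat) : exists a, A a /\ R n a.
  by have [a Aa Rna] := Rt n I; exists a.
exists e; split=> [n|i j eij]; first by have [] := eP n.
by apply: (Ri i j (e i)) => //; [case: (eP i)|rewrite eij; case: (eP j)].
Qed.

(** * The square of an infinite set *)

Section square.
Variables (T : Type) (A : set T).

Let dom (G : set (T * T * T)) : set T := [set x | exists y z, G (x, y, z)].

(** A total and injective pairing relation on [dom G] with values in [dom G], which lies inside [A].
    With the domain read off the graph, Zorn's lemma applies to plain sets of triples. *)
Let square_graph (G : set (T * T * T)) :=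
  [/\ forall x y z, G (x, y, z) -> [/\ A x, dom G y & dom G z],
      forall x y, dom G x -> dom G y -> exists z, G (x, y, z) &
      forall x y x' y' z, G (x, y, z) -> G (x', y', z) -> x = x' /\ y = y'].

Let square_graph_bigcup (F : set (set (T * T * T))) :
  (exists G, F G) -> (forall G, F G -> square_graph G) -> total_on F subset ->
  square_graph (\bigcup_(G in F) G).
Proof.
move=> [G0 FG0] Fsq Ftot.
have domS G : F G -> dom G `<=` dom (\bigcup_(G in F) G).
  by move=> FG x [y [z Gxyz]]; exists y, z, G.
have domU x y : dom (\bigcup_(G in F) G) x -> dom (\bigcup_(G in F) G) y ->
    exists2 G, F G & dom G x /\ dom G y.
  move=> [x1 [x2 [G FG Gx]]] [y1 [y2 [G' FG' Gy]]].
  have [GG'|G'G] := Ftot _ _ FG FG'.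
    exists G' => //; split; [exists x1, x2; exact: GG'|by exists y1, y2].
  exists G => //; split; [by exists x1, x2|exists y1, y2; exact: G'G].
split=> [x y z [G FG Gxyz]|x y|x y x' y' z [G FG Gxyz] [G' FG' Gxyz']].
- have [GA _ _] := Fsq _ FG; have [Ax Gy Gz] := GA _ _ _ Gxyz.
  by split=> //; apply: domS Gy || apply: domS Gz.
- move=> dx dy; have [G FG [Gx Gy]] := domU _ _ dx dy.
  have [_ Gt _] := Fsq _ FG; have [z Gxyz] := Gt _ _ Gx Gy.
  by exists z, G.
- have [GG'|G'G] := Ftot _ _ FG FG'.
    by have [_ _] := Fsq _ FG'; apply; [exact: GG' Gxyz|exact: Gxyz'].
  by have [_ _] := Fsq _ FG; apply; [exact: Gxyz|exact: G'G Gxyz'].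
Qed.

(** A maximal pairing lives on some [B] inside [A]. If the rest of [A] embeds in [B], then [A]
    embeds in [B] by tagging, and so does its square. Otherwise a disjoint copy of [B] in [A] allows
    the pairing to be extended, against maximality. *)
Lemma card_setX_infinite : infinite_set A -> A `*` A #<= A.
Proof.
move=> /infinite_seq_inj[e [eA einj]].
pose G0 : set (T * T * T) :=
  [set g | exists i j, g = (e i, e j, e (choice.pickle (i, j)))].
have dom0 x : dom G0 x <-> exists i, x = e i.
  split=> [[y [z [i [j [-> _ _]]]]]|[i ->]]; first by exists i.
  by exists (e 0%N), (e (choice.pickle (i, 0%N))), i, 0%N.
have sq0 : square_graph G0.
  split=> [x y z [i [j [-> -> ->]]]|x y /dom0[i ->] /dom0[j ->]|].
  - by split=> //; apply/dom0; eexists.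
  - by exists (e (choice.pickle (i, j))), i, j.
  - move=> x y x' y' z [i [j [-> -> ->]]] [i' [j' [-> ->]]].
    by move=> /einj/(pcan_inj choice.pickleK)[<- <-].
(* Adjoining [G0] makes the maximal pairing extend one on a countable set and lets the empty chain
   through. *)
have [F FP Ftot|G [PG Gmax]] := @Zorn_bigcup _ [set G | square_graph (G `|`
  G0)].
  have [[G1 FG1]|F0] := pselect (exists G, F G); last first.
    rewrite /= bigcup0 ?set0U// => G FG.
    by exfalso; apply: F0; exists G.
  rewrite /= (_ : _ `|` _ = \bigcup_(G in [set G `|` G0 | G in F]) G).
    apply: square_graph_bigcup.
    - by exists (G1 `|` G0), G1.
    - by move=> _ [G FG <-]; exact: FP.
    - move=> _ _ [G FG <-] [G' FG' <-].
      by have [GG'|GG'] := Ftot _ _ FG FG'; [left|right]; exact: setSU.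
  apply/seteqP; split=> [g [[G FG Gg]|G0g]|g [_ [G FG <-] [Gg|G0g]]].
  - by exists (G `|` G0); [exists G|left].
  - by exists (G1 `|` G0); [exists G1|right].
  - by left; exists G.
  - by right.
set H := G `|` G0 in PG.
have [HA Ht Hi] := PG.
pose B := dom H.
have BA : B `<=` A by move=> x [y [z /HA[]]].
have Be i : B (e i).
  by exists (e 0%N), (e (choice.pickle (i, 0%N))); right; exists i, 0%N.
have Bfst x y z : H (x, y, z) -> B x by exists y, z.
have /choice[f0 f0P] : forall p : T * T, exists z, B p.1 -> B p.2 ->
  H (p.1, p.2, z).
  move=> [x y]; have [[Bx By]|nB] := pselect (B x /\ B y).
    by have [z Hz] := Ht _ _ Bx By; exists z.
  by exists x => Bx By; exfalso; apply: nB.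
pose f x y := f0 (x, y).
have fH x y : B x -> B y -> H (x, y, f x y) by exact: (f0P (x, y)).
have fB x y : B x -> B y -> B (f x y) by move=> Bx By;
  have [] := HA _ _ _ (fH _ _ Bx By).
have finj x y x' y' : B x -> B y -> B x' -> B y' -> f x y = f x' y' ->
    x = x' /\ y = y'.
  move=> Bx By Bx' By' fe; apply: (Hi _ _ _ _ (f x y)); first exact: fH.
  by rewrite fe; exact: fH.
have e01 : e 0%N <> e 1%N by move/einj.
have [/card_le_fun[j [jB jinj]]|/card_le_fun[j [jA jinj]]] :=
    card_le_total (A `\` B) B.
  pose h a := if pselect (B a) is left _ then f (e 0%N) a else f (e 1%N) (j a).
  have hB a : A a -> B (h a).
    by move=> Aa; rewrite /h; case: pselect => [Ba|nBa]; apply: fB => //;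
      exact: jB.
  have hinj a a' : A a -> A a' -> h a = h a' -> a = a'.
    move=> Aa Aa'; rewrite /h; case: pselect => Ba; case: pselect => Ba'.
    - by move=> /finj[].
    - by move=> /finj[]// ; exact: jB.
    - by move=> /finj[]// ; [exact: jB|move/esym].
    - by move=> /finj[]// ; [exact: jB|exact: jB|move=> _; exact: jinj].
  apply: (@card_le_inj _ _ _ _ (fun p => f (h p.1) (h p.2))).
    by move=> p [Ap1 Ap2]; apply: BA; apply: fB; exact: hB.
  move=> [p1 p2] [q1 q2] [/= Ap1 Ap2] [/= Aq1 Aq2] /finj[]; try exact: hB.
  by move=> /hinj -> // /hinj ->.
exfalso.
(* [L] codes a point of [B] or of its copy under [j] by a tag and a member of [B]. [N] sends the
   pairs not lying in [B] to the copy, where no value of [H] lies. *)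
pose L x t u := (B x /\ t = e 0%N /\ u = x) \/
  (exists2 b, B b & [/\ x = j b, t = e 1%N & u = b]).
have LB x t u : L x t u -> B t /\ B u.
  by move=> [[? [-> ->]]|[b ? [_ -> ->]]].
have Linj x x' t u : L x t u -> L x' t u -> x = x'.
  move=> [[_ [tE uE]]|[b _ [xE tE uE]]] [[_ [tE' uE']]|[b' _ [xE' tE' uE']]].
  - by rewrite -uE -uE'.
  - by case: e01; rewrite -tE.
  - by case: e01; rewrite -tE'.
  - by rewrite xE xE' -uE uE'.
pose N : set (T * T * T) := [set g | exists t u t' u', [/\ L g.1.1 t u,
  L g.1.2 t' u', ~ (t = e 0%N /\ t' = e 0%N) & g.2 = j (f (f t t') (f u u'))]].
have domN x : dom (H `|` N) x <-> exists t u, L x t u.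
  split=> [[y [z [/Bfst Bx|[t [u [t' [u' [/= Lx _ _ _]]]]]]]]|[t [u Lx]]].
  - by exists (e 0%N), x; left.
  - by exists t, u.
  - exists (j (e 0%N)), (j (f (f t (e 1%N)) (f u (e 0%N)))); right.
    exists t, u, (e 1%N), (e 0%N); split=> //=; first by right; exists (e 0%N).
    by move=> [_ /esym].
have LA x t u : L x t u -> A x.
  by move=> [[/BA//]|[b /jA[Ajb _] [-> _ _]]].
have nHj x y b : B b -> ~ H (x, y, j b).
  by move=> Bb /HA[_ _]; have [] := jA _ Bb.
have NB x y z : N (x, y, z) -> exists2 b, B b & z = j b.
  move=> [t [u [t' [u' [/= /LB[Bt Bu] /LB[Bt' Bu'] _ ->]]]]].
  by exists (f (f t t') (f u u')) => //; apply: (fB); exact: (fB).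
have sqHN : square_graph (H `|` N).
  split=> [x y z [Hxyz|Nxyz]|x y /domN[t [u Lx]] /domN[t' [u' Ly]]|].
  - have [Ax By Bz] := HA _ _ _ Hxyz; split=> //; apply/domN.
      by exists (e 0%N), y; left.
    by exists (e 0%N), z; left.
  - have [b Bb zE] := NB _ _ _ Nxyz.
    have [t [u [t' [u' [/= Lx Ly _ _]]]]] := Nxyz.
    split; [exact: LA Lx|by apply/domN; exists t', u'|].
    by apply/domN; exists (e 1%N), b; right; exists b.
  - have [tt|tt] := pselect (t = e 0%N /\ t' = e 0%N); last first.
      by exists (j (f (f t t') (f u u'))); right; exists t, u, t', u'.
    have [t0 t'0] := tt.
    have L0 v w : L v (e 0%N) w -> B v by move=> [[]//|[b _ [_ /e01]]].
    have [z Hz] := Ht x y (L0 x u ltac:(by rewrite -t0))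
                          (L0 y u' ltac:(by rewrite -t'0)).
    by exists z; left.
  - move=> x y x' y' z [Hz|Nz] [Hz'|Nz'].
    + exact: Hi Hz Hz'.
    + by have [b Bb zE] := NB _ _ _ Nz'; rewrite zE in Hz;
      have := nHj x y _ Bb Hz.
    + by have [b Bb zE] := NB _ _ _ Nz; rewrite zE in Hz';
      have := nHj x' y' _ Bb Hz'.
    + move: Nz Nz' => [t [u [t' [u' [/= Lx Ly _ zE]]]]].
      move=> [s [v [s' [v' [/= Lx' Ly' _ zE']]]]]; rewrite zE in zE'.
      have [[Bt Bu] [Bt' Bu']] := (LB _ _ _ Lx, LB _ _ _ Ly).
      have [[Bs Bv] [Bs' Bv']] := (LB _ _ _ Lx', LB _ _ _ Ly').
      have [Btt Buu] := (fB _ _ Bt Bt', fB _ _ Bu Bu').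
      have [Bss Bvv] := (fB _ _ Bs Bs', fB _ _ Bv Bv').
      have ff := jinj _ _ (fB _ _ Btt Buu) (fB _ _ Bss Bvv) zE'.
      have [tt uu] := finj _ _ _ _ Btt Buu Bss Bvv ff.
      have [ts ts'] := finj _ _ _ _ Bt Bt' Bs Bs' tt.
      have [uv uv'] := finj _ _ _ _ Bu Bu' Bv Bv' uu.
      subst s s' v v'.
      by split; [exact: Linj Lx Lx'|exact: Linj Ly Ly'].
have Lj : L (j (e 0%N)) (e 1%N) (e 0%N) by right; exists (e 0%N).
have Nj : N (j (e 0%N), j (e 0%N), j (f (f (e 1%N) (e 1%N)) (f (e 0%N) (e
  0%N)))).
  by exists (e 1%N), (e 0%N), (e 1%N), (e 0%N); split=> // -[/esym].
apply: (Gmax (G `|` N)).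
  split; first by move=> g Gg; left.
  move=> /(_ _ (or_intror Nj)) Gj; have [b Bb bE] := NB _ _ _ Nj.
  by apply: (nHj (j (e 0%N)) (j (e 0%N)) _ Bb); rewrite -bE; left.
by rewrite /= -setUA (setUC N) setUA.
Qed.
End square.

(** * Infinitely often equal functions *)

Definition io_eq (f g : nat -> nat) := forall N, exists2 n, N <= n & f n = g n.

(** A dense open subset of Cantor space, presented by words whose cones it is the union of. *)
Definition dense_open (D : seq bool -> Prop) :=
  (forall s, exists t, D (s ++ t)) /\ (forall s t, D s -> D (s ++ t)).

(** There are finitely many words of length [k] and indices [l] up to [k], and a word can be
    prolonged for one pair after the other. So [w k] can be written at position [k] without
    knowledge of what precedes it. *)
Lemma dense_open_word (D : nat -> seq bool -> Prop) :
  (forall l, dense_open (D l)) ->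
  exists w : nat -> seq bool,
    forall k t l, size t = k -> l <= k -> D l (t ++ w k).
Proof.
move=> DD.
have aux (r : seq (seq bool * nat)) :
    exists w, forall p, p \in r -> D p.2 (p.1 ++ w).
  elim: r => [|[t l] r [w wP]]; first by exists [::].
  have [u uP] := (DD l).1 (t ++ w).
  exists (w ++ u) => -[t' l']; rewrite inE => /predU1P[[-> ->]|/wP/= Dw].
    by rewrite catA.
  by rewrite catA; exact: (DD l').2.
have /choice[w wP] (k : nat) : exists w : seq bool, forall (t : k.-tuple bool)
    (l : 'I_k.+1), D l (t ++ w).
  have [w wP] := aux [seq (tval p.1, nat_of_ord p.2) |
    p <- enum {: k.-tuple bool * 'I_k.+1}].
  exists w => t l; apply: (wP (tval t, nat_of_ord l)).
  by apply/mapP; exists (t, l); rewrite ?mem_enum.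
exists w => k t l /eqP tk lk.
exact: (wP k (Tuple tk) (Ordinal (lk : l < k.+1))).
Qed.

Lemma mkseqD (T : Type) (z : nat -> T) m n :
  mkseq z (m + n) = mkseq z m ++ mkseq (fun i => z (m + i)) n.
Proof.
rewrite /mkseq iotaD map_cat add0n; congr (_ ++ _).
by rewrite -[in iota m n](addn0 m) iotaDl -map_comp.
Qed.

Section blocks.
Variable f : nat -> nat.

(** The summand [n] makes the starts strictly increasing, and the sum puts the start of the n-th
    block at or beyond [f n]. *)
Definition block_start n := n + \sum_(i < n.+1) f i.

Lemma block_startS n : block_start n < block_start n.+1.
Proof.
by rewrite /block_start [\sum_(i < n.+2) _]big_ord_recr /= addSn ltnS leq_add2l
  leq_addr.
Qed.

Lemma block_start_lt m n : m < n -> block_start m < block_start n.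
Proof.
elim: n => // n IHn; rewrite ltnS leq_eqVlt => /predU1P[->|/IHn].
  exact: block_startS.
by move=> h; exact: (ltn_trans h (block_startS n)).
Qed.

Lemma leq_block_start n : n <= block_start n. Proof. exact: leq_addr. Qed.

Lemma block_start_ge n : f n <= block_start n.
Proof. by rewrite /block_start big_ord_recr /= addnA leq_addl. Qed.

Definition block i := xget 0 [set n | block_start n <= i < block_start n.+1].

Lemma blockE n i : block_start n <= i < block_start n.+1 -> block i = n.
Proof.
move=> ni; apply: xget_unique => // m /andP[mi im]; case/andP: ni => ni iSn.
have [mn|nm|//] := ltngtP m n.
  have := leq_ltn_trans ni im; rewrite ltnNge.
  by move: mn; rewrite leq_eqVlt => /predU1P[->|/block_start_lt/ltnW->];
    rewrite ?leqnn.
have := leq_ltn_trans mi iSn; rewrite ltnNge.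
by move: nm; rewrite leq_eqVlt => /predU1P[->|/block_start_lt/ltnW->];
  rewrite ?leqnn.
Qed.

Definition fits (w : nat -> seq bool) n :=
  block_start n + size (w (block_start n)) <= block_start n.+1.

Definition reach (w : nat -> seq bool) k := (k + \sum_(i < k.+1) size (w i)).+1.

Lemma leq_reach w m n : m <= n -> reach w m <= reach w n.
Proof.
move=> mn; rewrite ltnS leq_add//.
rewrite -!(big_mkord xpredT (fun i => size (w i))).
by rewrite (@big_cat_nat _ _ _ m.+1 0 n.+1)//= leq_addr.
Qed.

(** If no block from [N] on can hold its word, each start is at most [reach] of the preceding one,
    so the starts are bounded by iterates of [reach]. But the n-th start is at least [f n], which
    infinitely often exceeds the n-th iterate at [n]. *)
Lemma fits_io w :
  io_eq f (fun n => (iter n (reach w) n).+1) ->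
  forall N, exists2 n, N <= n & fits w n.
Proof.
move=> fio N; apply: contrapT => nofit.
have hr n : N <= n -> block_start n.+1 <= reach w (block_start n).
  move=> Nn; rewrite ltnW// ltnS; apply: (@leq_trans
      (block_start n + size (w (block_start n)))).
    by rewrite ltnW// ltnNge; apply/negP => ?; apply: nofit; exists n.
  by rewrite leq_add2l big_ord_recr/= leq_addl.
have hiter j : block_start (N + j) <= iter j (reach w) (block_start N).
  elim: j => [|j IHj]; first by rewrite addn0.
  by rewrite addnS (leq_trans (hr _ _)) ?leq_addr//= leq_reach.
have itermono j a b : a <= b -> iter j (reach w) a <= iter j (reach w) b.
  by elim: j => //= j IHj ab; apply: leq_reach; exact: IHj.
have iterle j a : a <= iter j (reach w) a.
  elim: j => //= j IHj; rewrite (leq_trans IHj)// /reach -addSn.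
  by rewrite (leq_trans (leqnSn _))// leq_addr.
have [n] := fio (N + block_start N).
move=> nge fn; have := block_start_ge n; rewrite fn ltnNge => /negP; apply.
have Nn : N <= n by rewrite (leq_trans _ nge)// leq_addr.
have := hiter (n - N); rewrite subnKC// => /leq_trans; apply.
have -> : iter n (reach w) n = iter N (reach w) (iter (n - N) (reach w) n).
  by rewrite -iterD subnKC.
apply: (leq_trans _ (iterle N _)).
by apply: itermono; rewrite (leq_trans _ nge)// leq_addl.
Qed.

End blocks.

Section guess.
Variable g : nat -> nat.

Definition candidates n : seq (nat * seq bool) :=
  odflt [::] (choice.unpickle (g n)).

(* A stage with [n + 1] candidates has one that differs from the at most [n]
   earlier choices, so every correct guess contributes a new position. *)
Fixpoint assigned n : seq (nat * seq bool) :=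
  if n is n'.+1 then
    take 1 [seq p <- candidates n' | p.1 \notin unzip1 (assigned n')]
      ++ assigned n'
  else [::].

Lemma uniq_assigned n : uniq (unzip1 (assigned n)).
Proof.
elim: n => //= n IHn; case E: [seq _ <- _ | _] => [//|p r] /=.
rewrite take0 /= IHn andbT.
by have : p \in p :: r; [rewrite inE eqxx|rewrite -E mem_filter => /andP[]].
Qed.

Lemma size_assigned n : size (assigned n) <= n.
Proof.
elim: n => //= n IHn; rewrite size_cat -[n.+1]add1n leq_add//.
by rewrite size_take_min geq_minl.
Qed.

Lemma assigned_mono m n : m <= n -> {subset assigned m <= assigned n}.
Proof.
elim: n => [|n IHn]; first by rewrite leqn0 => /eqP ->.
rewrite leq_eqVlt => /predU1P[->//|/IHn mn] p /mn pn.
by rewrite /= mem_cat pn orbT.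
Qed.

Definition guessed a : seq bool := xget [::] [set u | exists n, (a,
  u) \in assigned n].

Lemma guessedE n a u : (a, u) \in assigned n -> guessed a = u.
Proof.
move=> aun; apply: xget_unique => [|v [m avm]]; first by exists n.
have uN := uniq_assigned (maxn m n).
have ain := assigned_mono (leq_maxl m n) avm.
have bin := assigned_mono (leq_maxr m n) aun.
move: uN ain bin; elim: (assigned _) => // -[b x] r IHr /= /andP[br ur].
rewrite !inE !xpair_eqE => /orP[/andP[/eqP -> /eqP ->]|avr].
  by move=> /orP[/andP[_ /eqP ->]//|/(map_f fst)/=]; rewrite (negPf br).
move=> /orP[/andP[/eqP ab _]|]; last exact: IHr.
by have := map_f fst avr; rewrite /= ab (negPf br).
Qed.

Lemma guessed_io (X : nat -> Prop) (v : nat -> seq bool) (q : nat ->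
  seq (nat * seq bool)) :
  (forall n, [/\ size (q n) = n.+1, uniq (unzip1 (q n)) &
    forall p, p \in q n -> [/\ n <= p.1, X p.1 & p.2 = v p.1]]) ->
  io_eq g (choice.pickle \o q) ->
  forall N, exists a, [/\ N <= a, X a & guessed a = v a].
Proof.
move=> qP gio N; have [n Nn gn] := gio N.
have [sq uq qX] := qP n.
have candE : candidates n = q n by rewrite /candidates gn /comp choice.pickleK.
case E : [seq p <- candidates n | p.1 \notin unzip1 (assigned n)] => [|[a u] r].
  exfalso; have : {subset unzip1 (q n) <= unzip1 (assigned n)}.
    move=> a /mapP[p pq ->]; apply: contraT => pn.
    by have : p \in [::]; [rewrite -E mem_filter pn candE|].
  move=> /(uniq_leq_size uq); rewrite !size_map sq ltnNge => /negP; apply.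
  exact: size_assigned.
have au : (a, u) \in candidates n.
  by have : (a, u) \in (a, u) :: r; [rewrite inE eqxx|rewrite -E mem_filter =>
    /andP[]].
have [na Xa /= uE] := qX (a, u) (ltac:(by rewrite -candE)).
exists a; split=> //; first exact: leq_trans na.
rewrite -uE; apply: (@guessedE n.+1).
by rewrite /= E /= inE eqxx.
Qed.

End guess.

Lemma infinite_lists (X : nat -> Prop) (v : nat -> seq bool) :
  (forall N, exists2 n, N <= n & X n) ->
  exists q : nat -> seq (nat * seq bool), forall n,
    [/\ size (q n) = n.+1, uniq (unzip1 (q n)) &
    forall p, p \in q n -> [/\ n <= p.1, X p.1 & p.2 = v p.1]].
Proof.
move=> Xinf; suff /choice[q qP] : forall n, exists q : seq (nat * seq bool),
    [/\ size q = n.+1, uniq (unzip1 q) &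
    forall p, p \in q -> [/\ n <= p.1, X p.1 & p.2 = v p.1]] by exists q.
move=> n; elim: n.+1 => [|j [q [sq uq qX]]]; first by exists [::].
have [a aN Xa] := Xinf (n + (\sum_(p <- q) p.1).+1).
exists ((a, v a) :: q); split=> /=.
- by rewrite sq.
- rewrite uq andbT; apply/negP => /mapP[p pq ap].
  have : p.1 <= \sum_(p <- q) p.1 by rewrite (big_rem p)//= leq_addr.
  by rewrite leqNgt -ap => /negP; apply; exact: leq_trans (leq_addl _ _) aN.
- move=> p; rewrite inE => /predU1P[->/=|/qX//]; split=> //.
  exact: leq_trans (leq_addr _ _) aN.
Qed.

(* Bartoszynski: [f] delimits blocks that are infinitely often long enough, and
   [f'] guesses the words that are to be written in them. *)
Lemma generic_point : exists zz : (nat -> nat) -> (nat -> nat) -> nat -> bool,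
  forall D : nat -> seq bool -> Prop, (forall l, dense_open (D l)) ->
  exists r, forall f, io_eq f r -> exists r', forall f', io_eq f' r' ->
    forall l, exists k, D l (mkseq (zz f f') k).
Proof.
exists (fun f f' i => nth false (guessed f' (block f i)) (i - block_start f
  (block f i))).
move=> D /dense_open_word[w wD].
exists (fun n => (iter n (reach w) n).+1) => f /fits_io fit.
have [q qP] := infinite_lists (fun n => w (block_start f n)) fit.
exists (choice.pickle \o q) => f' gio l.
have [a [la fa ga]] := @guessed_io f' (fits f w) (fun n =>
  w (block_start f n)) q qP gio l.
pose k := block_start f a.
exists (k + size (w k)); rewrite mkseqD.
rewrite [X in _ ++ X](_ : _ = w k); first by apply: wD;
  rewrite ?size_mkseq// (leq_trans la)// leq_block_start.
apply: (@eq_from_nth _ false); first by rewrite size_mkseq.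
move=> i; rewrite size_mkseq => iw; rewrite nth_mkseq//.
rewrite (@blockE f a) ?ga ?addKn// leq_addr/=.
by rewrite (leq_trans _ fa)// ltn_add2l.
Qed.

(** * Ideals given by posets of regions *)

Lemma compact_nat_cover (X : topologicalType) (K : set X) (U : nat -> set X) :
  compact K -> (forall n, open (U n)) -> K `<=` \bigcup_n U n ->
  exists N, K `<=` \bigcup_(n in [set n | n < N]) U n.
Proof.
move=> /compact_near_coveringP Kc oU KU.
have [|N _ NP] := Kc nat \oo (fun n x =>
  (\bigcup_(m in [set m | m < n]) U m) x) _.
  move=> x /KU[m _ Umx].
  exists (U m, [set n | m < n]); last by move=> [y n] [/= Uy mn]; exists m.
  by split; [exact: open_nbhs_nbhs (conj (oU m) Umx)|exists m.+1].
by exists N; exact: (NP N (leqnn N)).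
Qed.

Lemma compact_nat_homo (X : topologicalType) (K : set X) (U : nat -> set X) :
  compact K -> (forall n, open (U n)) -> K `<=` \bigcup_n U n ->
  (forall m n, m <= n -> U m `<=` U n) -> exists n, K `<=` U n.
Proof.
move=> Kc oU KU Um; have [N KN] := compact_nat_cover Kc oU KU.
by exists N => x /KN[n /= /ltnW/Um]; apply.
Qed.

Lemma sigma_generated_seqP (T : Type) (F : set (set T)) (A : set T) : F set0 ->
  sigma_generated F A <->
  exists K : nat -> set T, (forall n, F (K n)) /\ A `<=` \bigcup_n K n.
Proof.
move=> F0; split=> [[C [cC CF] AC]|[K [FK AK]]]; last first.
  exists (range K); last by rewrite bigcup_image.
  by split; [exact: (card_le_trans (card_image_le _ _))|move=> _ [n _ <-]].
have [C0|[f]] := pfcard_geP cC.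
  exists (fun=> set0); split=> // x /AC; rewrite C0 bigcup_set0.
  by case.
exists f; split=> [n|x /AC[B CB Bx]]; first by apply: CF; exact: funS.
by have [n _ nB] := @surj _ _ _ _ f B CB; exists n => //; rewrite nB.
Qed.

Lemma sigma_generated_sub (T : Type) (F : set (set T)) : F `<=` sigma_generated
  F.
Proof.
move=> A FA; exists [set A]; last by rewrite bigcup_set1.
by split=> [|_ ->//]; exact: countable1.
Qed.

Lemma sigma_generatedS (T : Type) (F : set (set T)) A B :
  A `<=` B -> sigma_generated F B -> sigma_generated F A.
Proof. by move=> AB [C CF BC]; exists C => //; exact: subset_trans BC. Qed.

Lemma sigma_generated_bigcup (T : Type) (F : set (set T)) (A : nat -> set T) :
  F set0 -> (forall n, sigma_generated F (A n)) ->
  sigma_generated F (\bigcup_n A n).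
Proof.
move=> F0 FA; apply/(sigma_generated_seqP _ F0).
have /choice[K KP] n := (sigma_generated_seqP (A n) F0).1 (FA n).
exists (fun m => if choice.unpickle m is Some p then K p.1 p.2 else set0).
split=> [m|x [n _ /(proj2 (KP n))[i _ Kx]]].
  by case: choice.unpickle => // p; exact: (KP p.1).1.
by exists (choice.pickle (n, i)) => //=; rewrite choice.pickleK.
Qed.

Lemma sigma_generatedU (T : Type) (F : set (set T)) A B : F set0 ->
  sigma_generated F A -> sigma_generated F B -> sigma_generated F (A `|` B).
Proof.
move=> F0 FA FB; rewrite (_ : A `|` B = \bigcup_n (if n is 0 then A else B)).
  by apply: sigma_generated_bigcup => // -[].
apply/seteqP; split=> [x [Ax|Bx]|x [[|n] _]];
  [by exists 0|by exists 1|left|right] => //.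
Qed.

(* A countable poset of conditions, each with an open region. A closed set is
   small when below every condition there is one whose region misses it. *)
Record avoidance (X : topologicalType) := Avoidance {
  cond : countType;
  below : cond -> cond -> Prop;
  region : cond -> set X;
  below_refl : forall c, below c c;
  below_trans : forall b a c, below a b -> below b c -> below a c;
  regionS : forall c c', below c' c -> region c' `<=` region c;
  region_open : forall c, open (region c);
  region_shrink : forall c,
    exists2 c', below c' c & closure (region c') `<=` region c }.

Section avoided.
Context {X : topologicalType} (S : avoidance X).
Implicit Types (A K : set X) (c : cond S).

(** Closures make the family of compact sets that miss a region open in the Vietoris topology; by
    [avoidedW], open regions would define the same sets. *)
Definition avoided A := forall c,
  exists2 c', below c' c & A `&` closure (region c') = set0.

Definition closed_avoided A := closed A /\ avoided A.

Definition avoidance_ideal := sigma_generated closed_avoided.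

Definition spread := forall c, exists s : nat -> cond S,
  (forall k, below (s k) c) /\
  (forall k l, region (s k) `&` region (s l) !=set0 -> k = l).

Definition thin := forall A, closed_avoided A -> A° = set0.

Lemma avoidedW A :
  (forall c, exists2 c', below c' c & A `&` region c' = set0) -> avoided A.
Proof.
move=> h c; have [c' c'c Ac'] := h c; have [c'' cc' rc''] := region_shrink c'.
exists c''; first exact: below_trans c'c.
by rewrite -subset0 -Ac'; exact: setIS.
Qed.

Lemma avoidedS A K : A `<=` K -> avoided K -> avoided A.
Proof.
move=> AK h c; have [c' c'c Ac'] := h c; exists c' => //.
by rewrite -subset0 -Ac'; exact: setSI.
Qed.

Lemma avoided0 : avoided set0.
Proof. by move=> c; exists c; [exact: below_refl|rewrite set0I]. Qed.

Lemma closed_avoided0 : closed_avoided set0.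
Proof. by split; [exact: closed0|exact: avoided0]. Qed.

Lemma avoidedU A K : avoided A -> avoided K -> avoided (A `|` K).
Proof.
move=> hA hK c; have [c' c'c Ac'] := hA c; have [c'' cc' Kc'] := hK c'.
exists c''; first exact: below_trans c'c.
rewrite setIUl Kc' setU0 -subset0 -Ac'; apply: setIS; apply: closureS.
exact: regionS.
Qed.

Lemma closed_avoidedU A K :
  closed_avoided A -> closed_avoided K -> closed_avoided (A `|` K).
Proof.
by move=> [cA hA] [cK hK]; split; [exact: closedU|exact: avoidedU].
Qed.

Lemma avoidance_ideal_homoP A : avoidance_ideal A <->
  exists K : nat -> set X, [/\ forall n, closed_avoided (K n),
    forall m n, m <= n -> K m `<=` K n & A `<=` \bigcup_n K n].
Proof.
rewrite /avoidance_ideal (sigma_generated_seqP _ closed_avoided0).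
split=> [[K [KP AK]]|[K [KP Km AK]]]; last by exists K.
exists (fun n => \bigcup_(m in [set m | m <= n]) K m); split=> [n|m n mn|].
- elim: n => [|n IHn].
    rewrite (_ : \bigcup_(_ in _) _ = K 0)//; apply/seteqP.
    by split=> [x [m /=]|x Kx]; [rewrite leqn0 => /eqP ->|exists 0].
  rewrite (_ : \bigcup_(_ in _) _ = \bigcup_(m in [set m | m <= n]) K m `|` K
    n.+1).
    exact: closed_avoidedU.
  apply/seteqP; split=> x.
    by move=> [m /=]; rewrite leq_eqVlt => /predU1P[->|mn]; [right|left;
      exists m].
  by move=> [[m /= mn]|]; [exists m => //=; exact: leqW|exists n.+1 => /=].
- by apply: bigcup_subset => i /= im; exact: leq_trans mn.
- by move=> x /AK[n _ Kx]; exists n => //; exists n => /=.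
Qed.

Lemma avoided1 (x : X) : spread -> avoided [set x].
Proof.
move=> sS; apply: avoidedW => c; have [s [sc sd]] := sS c.
have [x0|nx0] := pselect (region (s 0) x); last first.
  by exists (s 0) => //; rewrite -subset0 => y [->].
exists (s 1) => //; rewrite -subset0 => y [-> x1].
by have /sd : region (s 0) `&` region (s 1) !=set0 by exists x.
Qed.

Lemma avoided_ideal : ideal avoided.
Proof.
split; [by exists set0; exact: avoided0|by move=> A B BA; exact: avoidedS|].
by move=> A B; exact: avoidedU.
Qed.

Lemma avoided_Gdelta_ideal : Gdelta_ideal avoided.
Proof.
split; first exact: avoided_ideal.
exists (fun n => if (choice.unpickle n : option (cond S)) is Some c then
  \bigcup_(c' in [set c' | below c' c])
    [set K : hyperspace X | sval K `<=` ~` closure (region c')] else setT).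
  move=> n; case: choice.unpickle => [c|]; last exact: openT.
  apply: bigcup_open => c' _.
  set V := [set K : hyperspace X | _].
  exists [set V]; last by rewrite bigcup_set1.
  move=> _ ->; exists [fset V]%fset; last by rewrite set_fset1 bigcap_set1.
  move=> _ /[!inE] ->; left; exists (~` closure (region c')) => //.
  exact/closed_openC/closed_closure.
apply/seteqP; split=> [K KS n _|K KS c].
  case: choice.unpickle => // c; have [c' c'c Kc'] := KS c.
  by exists c' => //=; exact/disjoints_subset.
have := KS (choice.pickle c) I; rewrite choice.pickleK => -[c' c'c Kc'].
by exists c' => //; apply/disjoints_subset.
Qed.

Lemma descending_seq (P : nat -> cond S -> Prop) c :
  (forall n c', exists2 c'', below c'' c' & P n c'') ->
  exists s : nat -> cond S, (forall n, below (s n) c /\ P n (s n)) /\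
    forall m n, m <= n -> below (s n) (s m).
Proof.
move=> /= h.
have /choice[g gP] (p : nat * cond S) : exists c'', below c'' p.2 /\ P p.1 c''.
  by have [c'' ? ?] := h p.1 p.2; exists c''.
pose s := fix s n := g (n, if n is m.+1 then s m else c).
have sS n : below (s n.+1) (s n) by exact: (gP (n.+1, s n)).1.
have smono m n : m <= n -> below (s n) (s m).
  elim: n => [|n IHn]; first by rewrite leqn0 => /eqP ->; exact: below_refl.
  rewrite leq_eqVlt => /predU1P[->|/IHn]; first exact: below_refl.
  exact: below_trans.
exists s; split=> // n; split; last by case: n => [|n]; exact: (gP (_, _)).2.
by apply: below_trans (smono 0 n (leq0n n)) _; exact: (gP (0, c)).1.
Qed.

(** Below each condition [c] a descending sequence avoids [K 0], [K 1], ... in turn. The complements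
    of its closed regions increase, so a compact set covered by them lies in one. Intersecting the
    unions of these complements over the countably many [c] gives the required G_delta set. *)
Lemma avoided_solecki : solecki avoided.
Proof.
move=> C cC CP.
have [K [KP CK]] : exists K : nat -> set X, (forall n, avoided (K n)) /\
    \bigcup_(A in C) A `<=` \bigcup_n K n.
  apply/(@sigma_generated_seqP _ avoided); first exact: avoided0.
  by exists C => //; split=> // A /CP[].
have /choice[s sP] (c : cond S) : exists s : nat -> cond S,
    (forall n, below (s n) c /\ K n `&` closure (region (s n)) = set0) /\
    forall m n, m <= n -> below (s n) (s m).
  apply: (@descending_seq (fun n (c : cond S) =>
    K n `&` closure (region c) = set0)).
  by move=> n; exact: KP.
exists (\bigcap_i (if (choice.unpickle i : option (cond S)) is Some c then
  \bigcup_n ~` closure (region (s c n)) else setT)); split.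
- exists (fun i => if (choice.unpickle i : option (cond S)) is Some c then
    \bigcup_n ~` closure (region (s c n)) else setT) => // i.
  case: choice.unpickle => [c|]; last exact: openT.
  by apply: bigcup_open => n _; exact/closed_openC/closed_closure.
- move=> x /CK[n _ Kx] i _; case: choice.unpickle => // c; exists n => //.
  have [sc _] := sP c; have [_ Ksc] := sc n.
  by move=> sx; suff : set0 x by []; rewrite -Ksc.
- move=> L cL LG c.
  have [||m n mn|n Ln] := @compact_nat_homo _ L
      (fun n => ~` closure (@region _ S (s c n))) cL.
  + by move=> n; exact/closed_openC/closed_closure.
  + by move=> x /LG/(_ (choice.pickle c) I); rewrite choice.pickleK.
  + by apply: subsetC; apply: closureS; apply: regionS; exact: (sP c).2.
  + by exists (s c n); [exact: ((sP c).1 n).1|exact/disjoints_subset].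
Qed.

Lemma avoidance_ideal_sigma_star : hausdorff_space X -> compact [set: X] ->
  sigma_star_ideal avoidance_ideal.
Proof.
move=> hX cX; split.
  split; first by exists set0; apply: sigma_generated_sub;
    exact: closed_avoided0.
  - by move=> A B; exact: sigma_generatedS.
  - by move=> A B; apply: sigma_generatedU; exact: closed_avoided0.
exists (fun=> avoided).
  by move=> _; split; [exact: avoided_Gdelta_ideal|exact: avoided_solecki].
congr sigma_generated; apply/seteqP; split=> [A [cA hA]|A [_ _ [hA cA]]].
  by exists 0 => //; split=> //; exact: (subclosed_compact cA cX).
by split=> //; exact: compact_closed.
Qed.

End avoided.

(** * Ideals governed by functions *)

Definition dominated (h g : nat -> nat) := exists N, forall n, N <= n ->
  h n <= g n.

Definition meets (z : nat -> bool) (D : nat -> seq bool -> Prop) :=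
  forall l, exists k, D l (mkseq z k).

Lemma io_eqxx f : io_eq f f. Proof. by move=> N; exists N. Qed.

(** The construction of a generic sequence is tried for all members of [C] at once. It fails only if
    the functions required in one of its two rounds have no common infinitely often equal function,
    and then these functions form the evasive family. *)
Lemma generic_or_evasive (T : Type) (C : set T) (D : T -> nat -> seq bool ->
  Prop) :
  (forall A, C A -> forall l, dense_open (D A l)) ->
  (exists z, forall A, C A -> meets z (D A)) \/
  exists G : T -> nat -> nat, forall f, exists2 A, C A & ~ io_eq f (G A).
Proof.
move=> DD; have [zz zzP] := generic_point.
have /choice[r rP] A : exists r, C A -> forall f, io_eq f r ->
    exists r', forall f', io_eq f' r' -> meets (zz f f') (D A).
  have [CA|nCA] := pselect (C A); last by exists (fun=> 0).
  by have [r rP] := zzP _ (DD _ CA); exists r.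
have [[f fr]|nf] := pselect (exists f, forall A, C A -> io_eq f (r A));
  last first.
  right; exists r => f; apply: contrapT => nA; apply: nf; exists f => A CA.
  by apply: contrapT => nio; apply: nA; exists A.
have /choice[r' r'P] A : exists r', C A -> forall f', io_eq f' r' ->
    meets (zz f f') (D A).
  have [CA|nCA] := pselect (C A); last by exists (fun=> 0).
  by have [r' r'P] := rP _ CA _ (fr _ CA); exists r'.
have [[f' fr']|nf] := pselect (exists f', forall A, C A -> io_eq f' (r' A)).
  by left; exists (zz f f') => A CA; apply: r'P => //; exact: fr'.
right; exists r' => f'; apply: contrapT => nA; apply: nf; exists f' => A CA.
by apply: contrapT => nio; apply: nA; exists A.
Qed.

(* Tukey-type connections with infinitely often equal functions,
  bounded functions
   and generic binary sequences, strong enough to determine the four cardinal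
   characteristics of [I]. *)
Record governed (X : Type) (I : set (set X)) := Governed {
  governed_sub : forall A B, A `<=` B -> I B -> I A;
  governed_countable : forall A, countable A -> I A;
  governed_evade : exists phi : X -> nat -> nat,
    forall g, I [set x | ~ io_eq (phi x) g];
  governed_bound : exists2 K : (nat -> nat) -> set X, forall h, I (K h) &
    forall A, I A -> exists b, forall h, K h `<=` A -> dominated h b;
  governed_trap : exists2 T : (nat -> bool) -> (nat -> nat) -> set X,
    forall z g, I (T z g) &
    forall A, I A -> exists2 D, forall l, dense_open (D l) &
      forall z, meets z D -> exists h, forall g, dominated h g -> A `<=` T z g;
  governed_point : exists theta : (nat -> bool) -> X,
    forall A, I A -> exists2 D, forall l, dense_open (D l) &
      forall z, meets z D -> ~ A (theta z) }.

Section governed.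
Variables (X : Type) (I J : set (set X)).
Hypotheses (gI : governed I) (gJ : governed J).

Lemma governed_proper : ~ I setT.
Proof.
have [theta thP] := governed_point gI; move=> /thP[D /= DD nD].
have [zz /(_ _ DD)[r rP]] := generic_point.
have [r' r'P] := rP r (@io_eqxx r).
by apply: (nD (zz r r')); [apply: r'P; exact: io_eqxx|].
Qed.

(** Every function is infinitely often equal to [phi x] for some [x] in [A], so two points of [A]
    yield the two functions behind a generic sequence. Hence pairs from [A] supply points outside
    every member of [J], and the square of [A] is no larger than [A], which is infinite. *)
Lemma governed_non A : ~ I A -> exists2 B, ~ J B & B #<= A.
Proof.
move=> nIA; have [phi phiP] := governed_evade gI.
have ioA g : exists2 x, A x & io_eq (phi x) g.
  apply: contrapT => nx; apply: nIA; apply: governed_sub (phiP g) =>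
    // x Ax nio.
  by apply: nx; exists x.
have [theta thP] := governed_point gJ; have [zz zzP] := generic_point.
exists [set theta (zz (phi p.1) (phi p.2)) | p in A `*` A].
  move=> /thP[D DD nD]; have [r rP] := zzP _ DD.
  have [x Ax xr] := ioA r; have [r' r'P] := rP _ xr.
  have [y Ay yr'] := ioA r'; apply: (nD (zz (phi x) (phi y))).
    exact: r'P.
  by exists (x, y).
apply: card_le_trans (card_image_le _ _) (card_setX_infinite _) => finA.
by apply: nIA; apply: (governed_countable gI); exact: finite_set_countable.
Qed.

Lemma governed_cov_evasive (T : Type) (C : set T) (G : T -> nat -> nat) :
  (forall f, exists2 A, C A & ~ io_eq f (G A)) ->
  exists C' : set (set X), [/\ C' `<=` J,
    \bigcup_(A in C') A = setT & C' #<= C].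
Proof.
move=> GP; have [phi phiP] := governed_evade gJ.
exists [set [set x | ~ io_eq (phi x) (G A)] | A in C]; split.
- by move=> _ [A CA <-]; exact: phiP.
- apply/seteqP; split=> // x _; have [A CA nio] := GP (phi x).
  by exists [set x | ~ io_eq (phi x) (G A)] => //; exists A.
- exact: card_image_le.
Qed.

Lemma governed_cov (C : set (set X)) : C `<=` I -> \bigcup_(A in C) A = setT ->
  exists2 C' : set (set X), C' `<=` J /\ \bigcup_(A in C') A = setT & C' #<= C.
Proof.
move=> CI CT; have [theta thP] := governed_point gI.
have /choice[D DP] A : exists D, C A -> (forall l, dense_open (D l)) /\
    forall z, meets z D -> ~ A (theta z).
  have [CA|nCA] := pselect (C A); last by exists (fun _ _ => True).
  by have [D DD nD] := thP _ (CI _ CA); exists D.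
have [|[z zP]|[G GP]] := @generic_or_evasive _ C D.
- by move=> A /DP[].
- have [A CA Az] : (\bigcup_(A in C) A) (theta z) by rewrite CT.
  by have [_ /(_ z (zP _ CA))] := DP _ CA.
- by have [C' [C'J C'T C'C]] := governed_cov_evasive GP; exists C'.
Qed.

(** If one generic [z] serves all members of [C], the functions [h A] have no common bound [b],
    since [T z b] would contain the union; the sets [K (h A)] carry this unboundedness over to [J].
    In the evasive case members of [J] even cover [X]. *)
Lemma governed_add (C : set (set X)) : ~ J setT ->
  C `<=` I -> ~ I (\bigcup_(A in C) A) ->
  exists2 C' : set (set X), C' `<=` J /\ ~ J (\bigcup_(A in C') A) & C' #<= C.
Proof.
move=> nJT CI nI; have [T TI TP] := governed_trap gI.
have /choice[D DP] A : exists D, C A -> (forall l, dense_open (D l)) /\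
    forall z, meets z D -> exists h, forall g, dominated h g -> A `<=` T z g.
  have [CA|nCA] := pselect (C A); last by exists (fun _ _ => True).
  by have [D DD nD] := TP _ (CI _ CA); exists D.
have [|[z zP]|[G GP]] := @generic_or_evasive _ C D.
- by move=> A /DP[].
- have /choice[h hP] A : exists h, C A -> forall g, dominated h g ->
  A `<=` T z g.
    have [CA|nCA] := pselect (C A); last by exists (fun=> 0).
    by have [_ /(_ _ (zP _ CA))[h hP]] := DP _ CA; exists h.
  have [K KJ KP] := governed_bound gJ.
  exists [set K (h A) | A in C]; last exact: card_image_le.
  split=> [_ [A CA <-]//|/KP[b bP]]; apply: nI.
  apply: (governed_sub gI) (TI z b) => x [A CA Ax].
  by apply: (hP A) => //; apply: bP => y Ky; exists (K (h A)) => //; exists A.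
- by have [C' [C'J C'T C'C]] := governed_cov_evasive GP; exists C' => //;
  rewrite C'T.
Qed.

(** A member of the new family is made from three members of [C]: points outside two of them give a
    generic sequence, and the third bounds the lengths. A finite [C] is impossible, as one of its
    members would contain all the chosen outside points. *)
Lemma governed_cof (C : set (set X)) : C `<=` I ->
  (forall B, I B -> exists2 A, C A & B `<=` A) ->
  exists2 C' : set (set X),
    C' `<=` J /\ (forall B, J B -> exists2 A, C' A & B `<=` A) & C' #<= C.
Proof.
move=> CI Ccof.
have /choice[p pP] A : exists x, C A -> ~ A x.
  have [CA|nCA] := pselect (C A); last first.
    by have [theta _] := governed_point gI; exists (theta (fun=> false)).
  have [x Ax] : exists x, ~ A x; last by exists x.
  apply: contrapT => nx; apply: governed_proper.
  rewrite (_ : setT = A); first exact: CI.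
  by apply/seteqP; split=> // x _; apply: contrapT => nAx; apply: nx; exists x.
have [phi phiP] := governed_evade gI.
have ioC g : exists2 A, C A & io_eq (phi (p A)) g.
  have [A CA gA] := Ccof _ (phiP g); exists A => //.
  by apply: contrapT => /gA; exact: pP.
have [K KI KP] := governed_bound gI.
have /choice[b bP] A : exists b, C A -> forall h, K h `<=` A -> dominated h b.
  have [CA|nCA] := pselect (C A); last by exists (fun=> 0).
  by have [b bP] := KP _ (CI _ CA); exists b.
have domC h : exists2 A, C A & dominated h (b A).
  by have [A CA KA] := Ccof _ (KI h); exists A => //; exact: bP.
have Cinf : infinite_set C.
  move=> finC; have [|A CA pA] := Ccof (p @` C).
    apply: (governed_countable gI); apply: finite_set_countable.
    exact: finite_image.
  by apply: (pP A CA); apply: pA; exists A.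
have [T TJ TP] := governed_trap gJ; have [zz zzP] := generic_point.
pose T' q := T (zz (phi (p q.1)) (phi (p q.2.1))) (b q.2.2).
exists (T' @` (C `*` (C `*` C))).
  split=> [_ [q _ <-]|B /TP[D DD DP]]; first exact: TJ.
  have [r rP] := zzP _ DD; have [A1 CA1 io1] := ioC r.
  have [r' r'P] := rP _ io1; have [A2 CA2 io2] := ioC r'.
  have [h hP] := DP _ (r'P _ io2); have [A3 CA3 hA3] := domC h.
  exists (T' (A1, (A2, A3))); last exact: hP.
  by exists (A1, (A2, A3)).
apply: card_le_trans (card_image_le _ _) _.
have C2 := card_setX_infinite Cinf; apply: card_le_trans C2.
have [R [Rt Ri]] := (card_le_relP _ _).1 (card_setX_infinite Cinf).
apply/card_le_relP; exists (fun x y => x.1 = y.1 /\ R x.2 y.2); split.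
  move=> [x1 x2] [/= Cx1 Cx2]; have [y Cy Rxy] := Rt _ Cx2.
  by exists (x1, y).
move=> [x1 x2] [y1 y2] [z1 z2] [/= _ Cx2] [_ Cy2] [-> Rx] [-> Ry].
by rewrite (Ri _ _ _ Cx2 Cy2 Rx Ry).
Qed.

End governed.

Theorem governed_cardinals (X : Type) (I J : set (set X)) :
  governed I -> governed J ->
  [/\ exists2 k, is_add I k & is_add J k,
      exists2 k, is_cov I k & is_cov J k,
      exists2 k, is_non I k & is_non J k &
      exists2 k, is_cof I k & is_cof J k].
Proof.
move=> gI gJ; have [nIT nJT] := (governed_proper gI, governed_proper gJ).
pose C : set (set X) := range set1.
have CI : C `<=` I.
  by move=> _ [x _ <-]; apply: (governed_countable gI); exact: countable1.
have CT : \bigcup_(A in C) A = setT.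
  by apply/seteqP; split=> // x _; exists [set x] => //; exists x.
split; apply: is_min_card_transfer.
- by exists C; split=> //; rewrite CT.
- by move=> A [? ?]; exact: (governed_add gI gJ).
- by move=> A [? ?]; exact: (governed_add gJ gI).
- by exists C.
- by move=> A [? ?]; exact: (governed_cov gI gJ).
- by move=> A [? ?]; exact: (governed_cov gJ gI).
- by exists setT.
- by move=> A /= ?; exact: (governed_non gI gJ).
- by move=> A /= ?; exact: (governed_non gJ gI).
- by exists I; split=> // B IB; exists B.
- by move=> A [? ?]; exact: (governed_cof gI gJ).
- by move=> A [? ?]; exact: (governed_cof gJ gI).
Qed.

Lemma enum_io (T : countType) : exists e : nat -> option T,
  forall c N, exists2 n, N <= n & e n = Some c.
Proof.
exists (fun n => omap snd (choice.unpickle n : option (nat * T))) => c N.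
have [n nN] : exists n : nat, N <= choice.pickle (n, c).
  apply: contrapT => nn.
  have lt (n : nat) : choice.pickle (n, c) < N by rewrite ltnNge;
    apply/negP => le; apply: nn; exists n.
  have pinj : injective (fun n : nat => choice.pickle (n, c)).
    by move=> i j /(pcan_inj choice.pickleK)[].
  suff : N.+1 <= N by rewrite ltnn.
  have sub : {subset [seq choice.pickle (i, c) | i <- iota 0 N.+1] <= iota 0 N}.
    by move=> _ /mapP[i _ ->]; rewrite mem_iota /= lt.
  have := uniq_leq_size _ sub; rewrite size_map !size_iota; apply.
  by rewrite map_inj_uniq ?iota_uniq.
by exists (choice.pickle (n, c)) => //; rewrite choice.pickleK.
Qed.

Section machine.
Context {X : topologicalType} (S : avoidance X) (e : nat -> option (cond S)).
Hypothesis eio : forall c N, exists2 n, N <= n & e n = Some c.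
Implicit Types (c : cond S) (s t : seq bool).

(* Descending sequences of conditions are coded by binary sequences, so that a
   dense set of conditions becomes a dense open set of words. *)
Definition run_step (p : cond S * nat) (b : bool) : cond S * nat :=
  if b then (if e p.2 is Some c then if `[< below c p.1 >] then c else p.1
             else p.1, 0)
  else (p.1, p.2.+1).

Definition run c s := (foldl run_step (c, 0) s).1.

Lemma run_step_below p b : below (run_step p b).1 p.1.
Proof.
case: p => c n; case: b => /=; last exact: below_refl.
case: (e n) => [c'|]; last exact: below_refl.
by case: ifPn => [/asboolP|_]//; exact: below_refl.
Qed.

Lemma run_cat_below c s t : below (run c (s ++ t)) (run c s).
Proof.
rewrite /run foldl_cat; elim: t (foldl _ _ s) => [|b t IHt] p /=.
  exact: below_refl.
exact: below_trans (IHt _) (run_step_below p b).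
Qed.

Lemma run_below c s : below (run c s) c.
Proof. exact: (run_cat_below c [::] s). Qed.

Lemma run_mkseq_below c z m n : m <= n ->
  below (run c (mkseq z n)) (run c (mkseq z m)).
Proof. by move=> mn; rewrite -(subnKC mn) mkseqD; exact: run_cat_below. Qed.

(** Zeros advance the counter, and a one adopts the condition at the counter if it lies below the
    current one. As every condition is enumerated infinitely often, enough zeros followed by a one
    lead to any chosen condition below. *)
Lemma run_dense_open (E : cond S -> Prop) c :
  (forall c, exists2 c', below c' c & E c') ->
  (forall c c', below c' c -> E c -> E c') ->
  dense_open (fun s => E (run c s)).
Proof.
move=> Ed Eo; split=> [s|s t]; last by apply: Eo; exact: run_cat_below.
rewrite /run; under eq_exists do rewrite foldl_cat.
case: (foldl _ _ s) => c' n.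
have [c'' c''c' Ec''] := Ed c'; have [m nm em] := eio c'' n.
exists (nseq (m - n) false ++ [:: true]); rewrite foldl_cat.
have -> k j : foldl run_step (c', j) (nseq k false) = (c', j + k).
  by elim: k j => [|k IHk] j /=; [rewrite addn0|rewrite IHk addSnnS].
by rewrite subnKC//= em asboolT.
Qed.

Definition trap (sel : nat -> cond S -> cond S) : set X :=
  [set x | exists N, forall j c, N <= j -> e j = Some c ->
    ~ region (sel j c) x].

(** The piece with bound [N] is closed, and each condition [c] returns at a stage [j] not before
    [N], where the region of [sel j c] misses the piece. *)
Lemma trap_ideal sel : (forall j c, below (sel j c) c) ->
  avoidance_ideal S (trap sel).
Proof.
move=> selb; apply/(sigma_generated_seqP _ (closed_avoided0 S)).
exists (fun N => \bigcap_(p in [set p : nat * cond S | N <= p.1 /\ e p.1 = Some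
  p.2])
   ~` region (sel p.1 p.2)); split=> [N|x [N xN]].
  split; first by apply: closed_bigI => p _; exact/open_closedC/region_open.
  apply: avoidedW => c; have [j Nj ej] := eio c N; exists (sel j c) => //.
  by apply/disjoints_subset => x /(_ (j, c)); apply.
by exists N => // -[j c] [Nj ej]; exact: xN.
Qed.

Definition caught (K : nat -> set X) (i : nat) (s : seq bool) : Prop :=
  if (choice.unpickle i : option (cond S * nat)) is Some p
  then K p.2 `&` region (run p.1 s) = set0 else True.

Lemma caught_dense_open K i : (forall n, avoided S (K n)) ->
  dense_open (caught K i).
Proof.
move=> Ka; rewrite /caught; case: choice.unpickle => [[c l]|]; last first.
  by split=> // s; exists [::].
apply: (@run_dense_open (fun c => K l `&` region c = set0)) =>
  [c'|c' c'' cc Kc /=].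
  have [c'' cc Kc] := Ka l c'; exists c'' => //.
  by rewrite -subset0 -Kc; apply: setIS; exact: subset_closure.
by rewrite -subset0 -Kc; apply: setIS; exact: regionS.
Qed.

(** [h j] is a length after which the run along [z] from the condition at stage [j] misses [K j].
    Longer words only lead further down, so every [g] that dominates [h] will do, and [K n] is
    inside [K j] at all late stages. *)
Lemma caught_trap (K : nat -> set X) z :
  (forall m n, m <= n -> K m `<=` K n) -> meets z (caught K) ->
  exists h, forall g, dominated h g ->
    \bigcup_n K n `<=` trap (fun j c => run c (mkseq z (g j))).
Proof.
move=> Km zK.
have /choice[h hP] j : exists k, forall c, e j = Some c ->
    K j `&` region (run c (mkseq z k)) = set0.
  case: (e j) => [c|]; last by exists 0.
  have [k] := zK (choice.pickle (c, j)); rewrite /caught choice.pickleK => zk.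
  by exists k => _ [<-].
exists h => g [N hg] x [n _ Kx]; exists (maxn n N) => j c nNj ej xr.
have [nj Nj] : n <= j /\ N <= j by move: nNj; rewrite geq_max => /andP.
suff : set0 x by []; rewrite -(hP _ _ ej); split; first exact: Km Kx.
by apply: regionS xr; apply: run_mkseq_below; exact: hg.
Qed.

End machine.

(** * Compact Hausdorff spaces with a countable base and their meager sets *)

Section base.
Context {X : topologicalType} (B : nat -> set X).
Hypotheses (hX : hausdorff_space X) (cX : compact [set: X]).
Hypothesis oB : forall i, open (B i).
Hypothesis baseB : forall U x, open U -> U x -> exists2 i, B i x & B i `<=` U.

Lemma base_regular U x : open U -> U x ->
  exists2 i, B i x & closure (B i) `<=` U.
Proof.
move=> oU Ux.
have [V nV cV] : filter_from (nbhs x) closure U.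
  apply: (@compact_regular X x setT hX cX (@filterT _ _ _) U).
  exact: open_nbhs_nbhs.
have [i Bx BV] := baseB (open_interior V) nV.
exists i => //; apply: subset_trans cV; apply: closureS.
exact: subset_trans BV (@interior_subset _ _).
Qed.

(** An empty region would be missed by every set, so empty base sets are replaced by the whole
    space. *)
Definition base_region i : set X := if `[< B i !=set0 >] then B i else setT.

Lemma base_region_open i : open (base_region i).
Proof. by rewrite /base_region; case: ifP => _; [exact: oB|exact: openT]. Qed.

Lemma base_regionE i x : B i x -> base_region i = B i.
Proof. by move=> Bx; rewrite /base_region asboolT//; exists x. Qed.

Variable x0 : X.

Lemma base_region0 i : base_region i !=set0.
Proof. by rewrite /base_region; case: asboolP => // _; exists x0. Qed.

Lemma base_region_shrink i :
  exists2 j, base_region j `<=` base_region i & closure (base_region j) `<=`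
    base_region i.
Proof.
have [x ix] := base_region0 i.
have [j jx cj] := base_regular (base_region_open i) ix.
rewrite -(base_regionE jx) in cj; exists j => //.
exact: subset_trans (@subset_closure _ _) cj.
Qed.

Definition base_avoidance : avoidance X :=
  @Avoidance X nat (fun i j => base_region i `<=` base_region j) base_region
    (fun=> @subset_refl _ _) (fun b a c => @subset_trans _ _ _ _)
    (fun c c' => id) base_region_open base_region_shrink.

Lemma base_avoidedP K : closed K -> avoided base_avoidance K <-> K° = set0.
Proof.
move=> cK; split=> [aK|K0 i].
  rewrite -subset0 => x /(baseB (open_interior K))[i ix iK].
  have [j /= ji Kj] := aK i; have [y jy] := base_region0 j.
  suff : set0 y by []; rewrite -Kj; split; last exact: subset_closure.
  by apply: interior_subset; apply: iK; rewrite -(base_regionE ix); exact: ji.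
have [x [Kx ix]] : (~` K `&` base_region i) !=set0.
  apply/set0P/eqP => Ki; suff : base_region i `<=` K°.
    by rewrite K0; have [x ix] := base_region0 i => /(_ _ ix).
  rewrite -open_subsetE; last exact: base_region_open.
  by rewrite -[K]setCK; apply/disjoints_subset; rewrite setIC.
have [|j jx cj] := @base_regular (~` K `&` base_region i) x _ (conj Kx ix).
  by apply: openI; [exact: closed_openC|exact: base_region_open].
rewrite -(base_regionE jx) in cj; exists j => /=.
  by move=> y jy; exact: (cj _ (subset_closure jy)).2.
by rewrite setIC; apply/disjoints_subset => y /cj[].
Qed.

Lemma meager_base : @meager X = avoidance_ideal base_avoidance.
Proof.
apply/seteqP; split=> [A|A]; last first.
  move=> [C [cC CS] AC]; exists C => //; split=> // K /CS[cK aK].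
  by rewrite /nowhere_dense /= -(closure_id K).1//; exact/base_avoidedP.
have nd0 : nowhere_dense (@set0 X) by rewrite /nowhere_dense /= closure0
  interior0.
move=> /(sigma_generated_seqP _ nd0)[K [Knd AK]].
apply/(sigma_generated_seqP _ (closed_avoided0 _)).
exists (fun n => closure (K n)); split=> [n|x /AK[n _ Kx]].
  by split; [exact: closed_closure|apply/base_avoidedP;
    [exact: closed_closure|exact: Knd]].
by exists n => //; exact: subset_closure.
Qed.

(** The closed regions along the run coded by [z] form a descending sequence of nonempty compact
    sets, and [theta z] is a common point. It is chosen before the sets [K] are known; these enter
    only through the dense open sets. *)
Lemma generic_base_point : exists theta : (nat -> bool) -> X,
  forall K : nat -> set X, (forall n, closed (K n) /\ (K n)° = set0) ->
  exists2 D, forall l, dense_open (D l) &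
    forall z, meets z D -> forall n, ~ K n (theta z).
Proof.
have [e eio] := enum_io nat.
pose r z k := base_region (@run _ base_avoidance e 0 (mkseq z k)).
have /choice[theta thP] (z : nat -> bool) :
    exists x, forall k, closure (r z k) x.
  apply: contrapT => nx.
  have [|x _|m n mn|k] := @compact_nat_homo _ setT (fun k =>
    ~` closure (r z k)) cX.
  - by move=> k; exact/closed_openC/closed_closure.
  - by apply: contrapT => nox; apply: nx; exists x => k; apply: contrapT => ?;
    apply: nox; exists k.
  - by apply: subsetC; apply: closureS; exact: (@run_mkseq_below _
    base_avoidance).
  - have [x xk] := base_region0 (@run _ base_avoidance e 0 (mkseq z k)).
    by move=> /(_ x I); apply; exact: subset_closure.
exists theta => K KP.
exists (fun n s => K n `&` closure (base_region (@run _ base_avoidance e 0 s))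
  = set0).
  move=> n; have [cK K0] := KP n.
  apply: (@run_dense_open _ base_avoidance e eio (fun c =>
    K n `&` closure (base_region c) = set0)).
    exact/base_avoidedP.
  by move=> c c' /= cc Kc; rewrite -subset0 -Kc; apply: setIS; exact: closureS.
move=> z zD n Kz; have [k Kk] := zD n; suff : set0 (theta z) by [].
by rewrite -Kk; split=> //; exact: thP.
Qed.

End base.
(** Once [i] and the starting history are fixed, the bound leaves finitely many histories of each
    length. Summing [beta] over these bounds [h], and the countably many choices of [i] and starting
    history are absorbed by a diagonal sum. *)
Lemma predicted_dominated (beta : nat -> seq nat -> nat)
    (pre : (nat -> nat) -> nat -> seq nat) :
  (forall h l, pre h l.+1 = h l :: pre h l) ->
  exists b, forall h,
    (exists i k, forall l, k <= l -> h l <= beta i (pre h l)) -> dominated h b.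
Proof.
move=> preS.
pose next i := fun V : seq (seq nat) =>
  flatten [seq [seq n :: v | n <- iota 0 (beta i v).+1] | v <- V].
pose M (p : nat * seq nat) d := \sum_(v <-
  iter d (next p.1) [:: p.2]) beta p.1 v.
have leqM p d v : v \in iter d (next p.1) [:: p.2] -> beta p.1 v <= M p d.
  by move=> vV; rewrite /M (big_rem v)//= leq_addr.
pose M' (p : nat * seq nat) l := \sum_(d < l.+1) M p d.
pose b l := \sum_(q < l.+1)
  oapp (fun p => M' p l) 0 (choice.unpickle q : option (nat * seq nat)).
exists b => h [i [k hk]].
pose p := (i, pre h k); pose q := choice.pickle p.
have hV d : pre h (k + d) \in iter d (next i) [:: pre h k].
  elim: d => [|d IHd]; first by rewrite addn0 /= inE.
  rewrite addnS preS /=; apply/flattenP.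
  exists [seq n :: pre h (k + d) | n <- iota 0 (beta i (pre h (k + d))).+1].
    by apply/mapP; exists (pre h (k + d)).
  by apply/mapP; exists (h (k + d)) =>
    //; rewrite mem_iota/= ltnS hk// leq_addr.
exists (k + q) => l kql.
have kl : k <= l by rewrite (leq_trans _ kql)// leq_addr.
have ql : q <= l by rewrite (leq_trans _ kql)// leq_addl.
apply: (leq_trans (hk _ kl)).
apply: (@leq_trans (M p (l - k))); first by apply: leqM;
  rewrite -[l in pre h l](subnKC kl) hV.
apply: (@leq_trans (M' p l)).
  rewrite /M' (bigD1 (Ordinal (leq_subr k l : l - k < l.+1)))//=.
  exact: leq_addr.
rewrite /b (bigD1 (Ordinal (ql : q < l.+1)))//= choice.pickleK /=.
exact: leq_addr.
Qed.

(** * The combinatorial connections for avoidance ideals *)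

Section governed_avoidance.
Context {X : topologicalType} (S : avoidance X) (B : nat -> set X).
Hypotheses (hX : hausdorff_space X) (cX : compact [set: X]).
Hypotheses (B0 : B 0 = setT) (oB : forall i, open (B i)).
Hypothesis baseB : forall U x, open U -> U x -> exists2 i, B i x & B i `<=` U.
Hypotheses (x0 : X) (sS : spread S) (tS : thin S).

Let regB := base_regular hX cX baseB.

Section enum.
Variable e : nat -> option (cond S).
Hypothesis eio : forall c N, exists2 n, N <= n & e n = Some c.

(** [phi x j] is the number of the region containing [x] among the disjoint ones below the condition
    at stage [j]. If it differs from [g j] at all late stages, [x] stays outside the regions
    numbered [g j] and lies in a trap. *)
Lemma spread_evade : exists phi : X -> nat -> nat,
  forall g, avoidance_ideal S [set x | ~ io_eq (phi x) g].
Proof.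
have /choice[s sP] := sS.
exists (fun x j => if e j is Some c then xget 0 [set k | region (s c k) x] else
  0) => g.
apply: (sigma_generatedS (B := trap e (fun j c => s c (g j)))).
  move=> x /=; apply: contra_notP => nx N; apply: contrapT => ng; apply: nx.
  exists N => j c Nj ej xr; apply: ng; exists j => //; rewrite ej.
  apply: xget_unique => // k xk; apply: (sP c).2.
  by exists x.
by apply: trap_ideal => // j c; exact: (sP c).1.
Qed.

Lemma avoided_points (T : eqType) (pt : T -> X) (P : seq T) :
  avoided S [set x | exists2 p, p \in P & x = pt p].
Proof.
elim: P => [|p P IHP].
  by apply: avoidedS (@avoided0 _ S) => x [].
apply: avoidedS (avoidedU (@avoided1 _ S (pt p) sS) IHP) => x [q].
by rewrite inE => /predU1P[->|qP] ->; [left|right; exists q].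
Qed.

(** Finitely many points, one in each nonempty intersection of [B i] with [B o], form an avoided
    set. So a region below the condition at stage [j] stays away from them, and small neighbourhoods
    of these points are the children. *)
Lemma children_exist j n (L : seq nat) : exists L' : seq nat, [/\
  forall o', o' \in L' -> exists2 o, o \in L & closure (B o') `<=` B o,
  forall o i, o \in L -> i <= n -> B i `&` B o !=set0 ->
    exists2 o', o' \in L' & closure (B o') `<=` B i `&` B o,
  forall c, e j = Some c -> exists2 c', below c' c &
    forall o', o' \in L' -> closure (B o') `&` region c' = set0 &
  forall o', o' \in L' -> B o' !=set0].
Proof.
pose P := [seq p <- [seq (o, i) | o <- L, i <- iota 0 n.+1] |
  `[< B p.2 `&` B p.1 !=set0 >]].
have /choice[pt ptP] (p : nat * nat) : exists x, p \in P -> (B p.2 `&` B p.1) x.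
  have [pP|] := boolP (p \in P); last by exists x0.
  by move: pP; rewrite mem_filter => /andP[/asboolP[x ?] _]; exists x.
have [V [ oV PV Ve]] : exists V : set X, [/\ open V, forall p, p \in P ->
  V (pt p) &
    forall c, e j = Some c -> exists2 c', below c' c & V `&` region c' = set0].
  case: (e j) => [c|]; last by exists setT; split=> //; exact: openT.
  have [c' c'c Pc'] := @avoided_points _ pt P c.
  exists (~` closure (region c')); split.
  - exact/closed_openC/closed_closure.
  - move=> p pP cl; suff : set0 (pt p) by [].
    by rewrite -Pc'; split=> //; exists p.
  - move=> _ [<-]; exists c' => //; apply/disjoints_subset; apply: subsetC.
    exact: subset_closure.
have /choice[ch chP] (p : nat * nat) : exists o, p \in P ->
    B o (pt p) /\ closure (B o) `<=` (B p.2 `&` B p.1) `&` V.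
  have [pP|] := boolP (p \in P); last by exists 0.
  have [||o ? ?] := @regB ((B p.2 `&` B p.1) `&` V) (pt p).
  - by apply: openI => //; exact: openI.
  - by split; [exact: ptP|exact: PV].
  - by exists o.
exists (map ch P); split.
- move=> _ /mapP[p pP ->]; exists p.1.
    by move: pP; rewrite mem_filter =>
      /andP[_ /flattenP[_ /mapP[a aL ->] /mapP[i _ ->]]].
  by move=> x /(proj2 (chP p pP))[[]].
- move=> o i oL ilen Bio; have oiP : (o, i) \in P.
    rewrite mem_filter asboolT//=; apply/flattenP.
    exists [seq (o, i) | i <- iota 0 n.+1]; apply/mapP;
      [by exists o|exists i => //].
    by rewrite mem_iota.
  exists (ch (o, i)); first exact: map_f.
  by move=> x /(proj2 (chP _ oiP))[].
- move=> c /Ve[c' c'c Vc']; exists c' => // _ /mapP[p pP ->].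
  by rewrite -subset0 -Vc'; apply: setSI => x /(proj2 (chP p pP))[].
- by move=> _ /mapP[p pP ->]; exists (pt p); exact: (chP p pP).1.
Qed.

(** The value [h l] says which base sets the children at level [l] have to enter. If [K h] is
    covered by closed sets [F i] with empty interior, a Baire argument gives one [F i] that meets
    all later closed cells below one cell. No child there may then enter a base set off [F i], which
    bounds [h l] in terms of the earlier values. *)
Lemma tree_bound : exists2 K : (nat -> nat) -> set X,
  forall h, avoidance_ideal S (K h) &
  forall A, avoidance_ideal S A ->
    exists b, forall h, K h `<=` A -> dominated h b.
Proof.
have /choice[ch0 chP0] (q : nat * nat * seq nat)
  := children_exist q.1.1 q.1.2 q.2.
pose ch j n L := ch0 (j, n, L).
have {chP0}chP (j n : nat) (L : seq nat) := chP0 (j, n, L);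
  rewrite /= -/(ch _ _ _) in chP.
pose lev := fix lev (u : seq nat) := if u is n :: v then ch (size v) n (lev v)
  else [:: 0].
pose pre := fix pre (h : nat -> nat) k
  := if k is l.+1 then h l :: pre h l else [::].
have size_pre h k : size (pre h k) = k by elim: k => //= k ->.
pose level h k := \bigcup_(o in [set` lev (pre h k)]) closure (B o).
have lev0 u o : o \in lev u -> B o !=set0.
  case: u => [|n u] /=; last by have [_ _ _] := chP (size u) n (lev u); apply.
  by rewrite inE => /eqP ->; rewrite B0; exists x0.
have levelS h k : level h k.+1 `<=` level h k.
  move=> x [ o' /= o'l xo'].
  have [+ _ _ _] := chP (size (pre h k)) (h k) (lev (pre h k)).
  move=> /(_ _ o'l)[ o ol oo']; exists o => //; apply: subset_closure;
    exact: oo'.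
have level_homo h m n : m <= n -> level h n `<=` level h m.
  elim: n => [|n IHn]; first by rewrite leqn0 => /eqP ->.
  rewrite leq_eqVlt => /predU1P[->//|/IHn]; exact: subset_trans.
exists (fun h => \bigcap_k level h k) => [h|A].
  apply: sigma_generated_sub; split.
    apply: closed_bigI => k _; apply: closed_bigcup.
      exact: finite_seq.
    by move=> o _; exact: closed_closure.
  apply: avoidedW => c; have [j _ ej] := eio c 0.
  have [_ _ + _] := chP (size (pre h j)) (h j) (lev (pre h j)).
  rewrite {1}size_pre => /(_ _ ej)[c' c'c hc']; exists c' => //.
  rewrite -subset0 => x [/(_ j.+1 I)[ o ol xo] xr].
  by suff : set0 x by []; rewrite -(hc' o ol).
move=> /(sigma_generated_seqP _ (closed_avoided0 S))[F [FP AF]].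
have /choice[bF bFP] (p : nat * nat) : exists i, B p.2 !=set0 ->
    B i `&` B p.2 !=set0 /\ B i `&` F p.1 = set0.
  have [[x px]|] := pselect (B p.2 !=set0); last by exists 0.
  have [y [py Fy]] : (B p.2 `&` ~` F p.1) !=set0.
    apply/set0P/eqP => pF; suff : (F p.1)° x by rewrite (tS (FP p.1)).
    have : B p.2 `<=` F p.1 by rewrite -[F _]setCK; apply/disjoints_subset.
    by rewrite (open_subsetE _ (oB _)) => /(_ _ px).
  have [|i iy iF] := @baseB (~` F p.1) y _ Fy;
    first exact: closed_openC (FP p.1).1.
  by exists i => _; split; [exists y|exact/disjoints_subset].
pose beta i u := \sum_(o <- lev u) bF (i, o).
have [b bP] := @predicted_dominated beta pre (fun h l => erefl).
exists b => h KA; apply: bP.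
(* Otherwise cells can be chosen one inside the other, with closures missing [F 0], [F 1], and so
   on; a common point of the closures lies in [K h] and in no [F n]. *)
have [i [k [ o [ ol oF]]]] : exists i k o, o \in lev (pre h k) /\
    forall k' o', k < k' -> o' \in lev (pre h k') -> B o' `<=` B o ->
      closure (B o') `&` F i !=set0.
  apply: contrapT => no.
  have /choice[nx nxP] (q : nat * (nat * nat)) : exists q' : nat * nat,
      q.2.2 \in lev (pre h q.2.1) ->
        [/\ q.2.1 < q'.1, q'.2 \in lev (pre h q'.1),
        B q'.2 `<=` B q.2.2 & closure (B q'.2) `&` F q.1 = set0].
    have [ql|] := boolP (q.2.2 \in lev (pre h q.2.1)); last by exists (0, 0).
    apply: contrapT => nq; apply: no; exists q.1, q.2.1, q.2.2; split=> //.
    move=> k' o' kk' ol' oo'; apply/set0P/eqP => oF; apply: nq.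
    by exists (k', o').
  pose s := fix s i := if i is j.+1 then nx (j, s j) else (0, 0).
  have sl i : (s i).2 \in lev (pre h (s i).1).
    by elim: i => [|i IHi] /=; [rewrite inE|have [] := nxP (i, s i) IHi].
  have sk i : i <= (s i).1.
    elim: i => // i IHi; apply: leq_ltn_trans IHi _.
    by have [] := nxP (i, s i) (sl i).
  have sB i : B (s i.+1).2 `<=` B (s i).2 by have [] := nxP (i, s i) (sl i).
  have sBm m n : m <= n -> B (s n).2 `<=` B (s m).2.
    elim: n => [|n IHn]; first by rewrite leqn0 => /eqP ->.
    rewrite leq_eqVlt => /predU1P[->//|/IHn]; exact: subset_trans.
  have sF i : closure (B (s i.+1).2) `&` F i = set0.
    by have [] := nxP (i, s i) (sl i).
  have [x xs] : exists x, forall n, closure (B (s n).2) x.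
    apply: contrapT => nx0.
    have [|x _|m n mn|n] := @compact_nat_homo _ setT (fun n =>
      ~` closure (B (s n).2)) cX.
    - by move=> n; exact/closed_openC/closed_closure.
    - by apply: contrapT => nox; apply: nx0; exists x => n;
      apply: contrapT => nxn; apply: nox; exists n.
    - by apply: subsetC; apply: closureS; exact: sBm.
    - have [x xn] := lev0 _ _ (sl n).
      by move=> /(_ x I); apply; exact: subset_closure.
  have /AF[n _ Fx] : A x.
    apply: KA => n _; apply: (level_homo h _ _ (sk n)).
    by exists (s n).2 => //=; exact: sl.
  suff : set0 x by [].
  by rewrite -(sF n); split.
exists i, k => l kl.
have [ o' [ o'l o'o]] : exists o', o' \in lev (pre h l) /\ B o' `<=` B o.
  rewrite -(subnKC kl); elim: (l - k) => [|d [ o' [ o'l o'o]]].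
    by rewrite addn0; exists o; split=> //; exact: subset_refl.
  rewrite addnS /=.
  have [_ + _ _] := chP (size (pre h (k + d))) (h (k + d)) (lev (pre h (k +
    d))).
  (* The index 0 is allowed at every level and [B 0] is the whole space, so every cell has a
     child. *)
  move=> /(_ o' 0 o'l (leq0n _)); rewrite B0 setTI =>
    /(_ (lev0 _ _ o'l))[ o'' o''l o''o'].
  exists o''; split=> //; apply: subset_trans o'o.
  exact: subset_trans (@subset_closure _ _) o''o'.
apply: (@leq_trans (bF (i, o'))); last by rewrite /beta (big_rem o')//=
  leq_addr.
rewrite leqNgt; apply/negP => bh.
have [bo bF0] := bFP (i, o') (lev0 _ _ o'l).
have [_ + _ _] := chP (size (pre h l)) (h l) (lev (pre h l)).
move=> /(_ o' (bF (i, o')) o'l (ltnW bh) bo)[ o'' o''l o''b].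
have [|x [xo Fx]] := oF l.+1 o'' kl o''l.
  apply: subset_trans o'o; apply: subset_trans (@subset_closure _ _) _.
  by move=> y /o''b[].
by suff : set0 x by []; rewrite -bF0; split=> //; exact: (o''b x xo).1.
Qed.

End enum.

Lemma avoidance_governed : governed (avoidance_ideal S).
Proof.
have [e eio] := enum_io (cond S).
split.
- by move=> A A'; exact: sigma_generatedS.
- move=> A cA; have [A0|[f]] := pfcard_geP cA.
    by rewrite A0; apply: sigma_generated_sub; exact: closed_avoided0.
  apply: (sigma_generatedS (B := \bigcup_n [set f n])).
    by move=> x Ax; have [n _ <-] := @surj _ _ _ _ f x Ax; exists n.
  apply: sigma_generated_bigcup => [|n]; first exact: closed_avoided0.
  apply: sigma_generated_sub; split; last exact: avoided1.
  exact/accessible_closed_set1/hausdorff_accessible.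
- exact: spread_evade eio.
- exact: tree_bound eio.
- exists (fun z g => trap e (fun j c => run e c (mkseq z (g j)))).
    by move=> z g; apply: trap_ideal => // j c; exact: run_below.
  move=> A /avoidance_ideal_homoP[K [Kca Km AK]].
  exists (caught e K) => [l|z zK].
    by apply: caught_dense_open => // n; exact: (Kca n).2.
  have [h hP] := caught_trap Km zK.
  by exists h => g hg; apply: subset_trans AK _; exact: hP.
- have [theta thP] := generic_base_point hX cX oB baseB x0.
  exists theta => A /(sigma_generated_seqP _ (closed_avoided0 S))[K [Kca AK]].
  have [|D DD DP] := thP K; first by move=> n; split;
    [exact: (Kca n).1|exact: tS].
  by exists D => // z zD /AK[n _]; exact: DP.
Qed.

End governed_avoidance.

(** * The cubes *)

Lemma set_val_continuous (X : topologicalType) (A : set X) :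
  continuous (val : A -> X).
Proof. exact: initial_continuous. Qed.

Lemma compact_set_type (X : topologicalType) (A : set X) :
  compact A -> compact [set: A].
Proof.
move=> cA F PF _.
have [p [Ap pF]] := cA (val @ F) _ (filterS (fun x _ => set_valP x) filterT).
exists (SigSub (mem_set Ap)); split=> // S N FS [_ [[V oV <-] Vp VN]].
have [|y [[s Ss <-] Vs]] := pF (val @` S) V _ (open_nbhs_nbhs (conj oV Vp)).
  by rewrite /= nbhs_filterE; apply: filterS FS => s Ss; exists s.
by exists s; split=> //; exact: VN.
Qed.

Lemma hausdorff_set_type (X : topologicalType) (A : set X) :
  hausdorff_space X -> hausdorff_space A.
Proof.
move=> hX x y xy; apply: val_inj; apply: hX => U V /= xU yV.
have [z [Uz Vz]] := xy (val @^-1` U) (val @^-1` V) (set_val_continuous xU)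
  (set_val_continuous yV).
by exists (val z).
Qed.

Section subbase.
Variables (T : topologicalType) (I : countType) (s : I -> set T).
Hypothesis os : forall i, open (s i).
Hypothesis cvgs : forall (x : T) (F : set_system T), Filter F ->
  (forall i, s i x -> F (s i)) -> F --> x.

Definition boxes (l : seq I) : set T := [set y | forall i, i \in l -> s i y].

Lemma boxes_cons i l : boxes (i :: l) = s i `&` boxes l.
Proof.
apply/seteqP; split=> [x xl|x [xi xl] j].
  by split=> [|j jl]; apply: xl; rewrite inE ?eqxx ?jl ?orbT.
by rewrite inE => /predU1P[->|/xl].
Qed.

Lemma open_boxes l : open (boxes l).
Proof.
elim: l => [|i l IHl]; last by rewrite boxes_cons; exact: openI.
by rewrite (_ : boxes _ = setT)//; [exact: openT|apply/seteqP; split].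
Qed.

Lemma subbase_boxes U x : open U -> U x ->
  exists2 l, boxes l x & boxes l `<=` U.
Proof.
move=> oU Ux.
pose F : set_system T := [set A | exists2 l, boxes l x & boxes l `<=` A].
have FF : Filter F.
  split; first by exists [::].
  - move=> A A' [l xl lA] [l' xl' lA']; exists (l ++ l').
      by move=> i; rewrite mem_cat => /orP[/xl|/xl'].
    by move=> y yl; split; [apply: lA|apply: lA'] => i il; apply: yl;
      rewrite mem_cat il ?orbT.
  - by move=> A A' AA' [l xl lA]; exists l => //; exact: subset_trans AA'.
apply: (@cvgs x F FF _ U); last exact: open_nbhs_nbhs.
move=> i xi; exists [:: i]; first by move=> j; rewrite inE => /eqP ->.
by move=> y; apply; rewrite inE.
Qed.

Lemma countable_base : exists B : nat -> set T, [/\ B 0 = setT,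
  forall i, open (B i) &
  forall U x, open U -> U x -> exists2 i, B i x & B i `<=` U].
Proof.
exists (fun n => if n is m.+1 then oapp boxes setT (choice.unpickle m) else
  setT).
split=> [//|[|m]|U x oU Ux]; first exact: openT.
  by case: choice.unpickle => [l|]; [exact: open_boxes|exact: openT].
have [l xl lU] := subbase_boxes oU Ux.
by exists (choice.pickle l).+1; rewrite choice.pickleK.
Qed.

End subbase.

Section cubes.
Context {R : realType}.
Local Notation I := (set_type (@unit_interval R)).

Lemma unit_interval_compact : compact [set: I].
Proof. by apply: compact_set_type; exact: segment_compact. Qed.

Lemma unit_interval_hausdorff : hausdorff_space I.
Proof. by apply: hausdorff_set_type; exact: Rhausdorff. Qed.

Lemma cube_compact n : compact [set: cube R n].
Proof.
have := @tychonoff (cube_index n) (fun=> I) (fun=> setT) (fun=>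
  unit_interval_compact).
by congr compact; apply/seteqP; split.
Qed.

Lemma cube_hausdorff n : hausdorff_space (cube R n).
Proof. by apply: hausdorff_product => i; exact: unit_interval_hausdorff. Qed.

Definition slab n (q : cube_index n * (rat * rat)) : set (cube R n) :=
  [set x | (ratr q.2.1 < val (x q.1) < ratr q.2.2)%R].

Lemma coord_continuous n (i : cube_index n) : continuous (fun x : cube R n =>
  val (x i) : R).
Proof.
move=> x; apply: (@continuous_comp (cube R n) I R (fun x => x i)).
  exact: (@proj_continuous _ (fun=> I) i).
exact: set_val_continuous.
Qed.

Lemma open_slab n q : open (@slab n q).
Proof.
rewrite (_ : slab q = (fun x : cube R n => val (x q.1) : R) @^-1`
   `](ratr q.2.1 : R), (ratr q.2.2 : R)[%classic).
  by apply: open_comp => [x _|]; [exact: coord_continuous|exact: itv_open].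
by apply/seteqP; split=> x /=; rewrite in_itv.
Qed.

Lemma cvg_slab n (x : cube R n) (F : set_system (cube R n)) : Filter F ->
  (forall q, slab q x -> F (@slab n q)) -> F --> x.
Proof.
move=> FF Fx; apply/cvg_sup => i N [_ [[U oU <-] Ux UN]].
rewrite nbhs_filterE; apply: filterS UN _.
case: oU Ux => V oV <- Vx.
have /nbhs_ballP[e /= e0 eV] : nbhs (val (x i) : R) V by exact: open_nbhs_nbhs.
have [|a] := @rat_in_itvoo R (val (x i) - e)%R (val (x i)).
  by rewrite ltrBlDr ltrDl.
rewrite in_itv /= => /andP[ea ax].
have [|b] := @rat_in_itvoo R (val (x i)) (val (x i) + e)%R.
  by rewrite ltrDl.
rewrite in_itv /= => /andP[xb be].
have := Fx (i, (a, b)); rewrite /slab/= ax xb => /(_ isT).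
apply: filterS => y /= /andP[ay yb]; apply: eV.
rewrite /ball /= ltr_distlC; apply/andP; split.
  exact: lt_trans ea ay.
exact: lt_trans yb be.
Qed.

Lemma cube_countable_base n : exists B : nat -> set (cube R n), [/\ B 0 = setT,
  forall i, open (B i) &
  forall U x, open U -> U x -> exists2 i, B i x & B i `<=` U].
Proof. exact: countable_base (@open_slab n) (@cvg_slab n). Qed.

Definition set_coord (x : cube R Omega) (i : nat) (t : I) : cube R Omega :=
  fun j => if j == i then t else x j.

(** A basic neighbourhood restricts finitely many coordinates, and by compactness one bound on them
    serves for all points of [K]. *)
Lemma set_coord_compact (K U : set (cube R Omega)) :
  compact K -> open U -> K `<=` U ->
  exists N, forall i x t, N <= i -> K x -> U (set_coord x i t).
Proof.
move=> /compact_near_coveringP Kc oU KU.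
have [|N _ NP] := Kc nat \oo (fun i x => forall t, U (set_coord x i t)) _.
  move=> x /KU Ux.
  have [l xl lU] := subbase_boxes (@cvg_slab Omega) oU Ux.
  exists (boxes (@slab Omega) l, [set i | forall q, q \in l -> q.1 < i]).
    split=> /=; first by apply: open_nbhs_nbhs; split=> //;
      exact: (open_boxes (@open_slab Omega)).
    exists (\sum_(q <- l) q.1).+1 => //= i li q ql.
    by apply: leq_trans li; rewrite ltnS (big_rem q)//= leq_addr.
  move=> [y i] [/= yl il] t; apply: lU => q ql.
  have := yl q ql; rewrite /slab /= /set_coord.
  by have := il q ql; case: eqP => // ->; rewrite ltnn.
by exists N => i x t Ni Kx; exact: (NP i Ni x Kx).
Qed.

End cubes.

(** * Z-sets *)

Definition basic_union (X : Type) (B : nat -> set X) (s : seq nat) : set X :=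
  \bigcup_(i in [set` s]) B i.

Section interpolation.
Context {X : topologicalType} (B : nat -> set X).
Hypotheses (hX : hausdorff_space X) (cX : compact [set: X]).
Hypothesis oB : forall i, open (B i).
Hypothesis baseB : forall U x, open U -> U x -> exists2 i, B i x & B i `<=` U.

Lemma open_basic_union s : open (basic_union B s).
Proof. exact: bigcup_open. Qed.

(** This is what keeps the sets of conditions countable: closed and open sets enter them only
    through finite unions of base sets. *)
Lemma interpolate (K V : set X) : closed K -> open V -> K `<=` V ->
  exists2 s, K `<=` basic_union B s & closure (basic_union B s) `<=` V.
Proof.
move=> cK oV KV; have Kc : compact K by exact: (subclosed_compact cK cX).
have [||N KN] := @compact_nat_cover _ K
    (fun i => if `[< closure (B i) `<=` V >] then B i else set0) Kc.
- by move=> i; case: ifP => _ //; exact: open0.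
- move=> x /KV /(base_regular hX cX baseB oV)[i Bx BV].
  by exists i => //; rewrite asboolT.
exists [seq i <- iota 0 N | `[< closure (B i) `<=` V >]].
  move=> x /KN[i /= iN]; case: ifP => // BV Bx; exists i => //=.
  by rewrite mem_filter BV mem_iota.
apply: (@subset_trans _ (\bigcup_(i in [set` [seq i <- iota 0 N |
    `[< closure (B i) `<=` V >]]]) closure (B i))); last first.
  by move=> x [i /=]; rewrite mem_filter => /andP[/asboolP BV _]; exact: BV.
have := (closure_id _).1 (closed_bigcup (finite_seq [seq i <- iota 0 N |
  `[< closure (B i) `<=` V >]]) (fun i _ => @closed_closure _ (B i))).
move=> ->; apply: closureS => x [i si Bx]; exists i => //.
exact: subset_closure.
Qed.

End interpolation.

Lemma continuous_range_closed (Y X : topologicalType) (f : Y -> X) (K : set Y) :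
  hausdorff_space X -> compact [set: Y] -> continuous f -> closed K ->
    closed (f @` K).
Proof.
move=> hX cY cf cK; apply: compact_closed => //.
apply: continuous_compact; first exact: continuous_subspaceT.
exact: (subclosed_compact cK cY).
Qed.

Section function_space.
Context {Y X : topologicalType} (BY : nat -> set Y) (BX : nat -> set X).
Hypotheses (hY : hausdorff_space Y) (cY : compact [set: Y]).
Hypothesis oBY : forall i, open (BY i).
Hypothesis baseBY : forall U x, open U -> U x ->
  exists2 i, BY i x & BY i `<=` U.
Hypotheses (hX : hausdorff_space X) (cX : compact [set: X]).
Hypothesis oBX : forall i, open (BX i).
Hypothesis baseBX : forall U x, open U -> U x ->
  exists2 i, BX i x & BX i `<=` U.

Definition maps_into (p : seq nat * seq nat) : set (cont_space Y X) :=
  [set f | f @` closure (basic_union BY p.1) `<=` basic_union BX p.2].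

Lemma open_image_sub (K : set Y) (U : set X) : compact K -> open U ->
  open [set f : cont_space Y X | f @` K `<=` U].
Proof.
move=> cK oU; exists [set f : {compact-open, Y -> X} | f @` K `<=` U] => //.
exact: compact_open_open.
Qed.

Lemma open_maps_into p : open (maps_into p).
Proof.
apply: open_image_sub; last exact: open_basic_union.
exact: (subclosed_compact (@closed_closure _ _) cY).
Qed.

(** Countably many constraints suffice, thanks to two interpolations: between [K] and the preimage
    of [O] in the domain, and between the image so obtained and [O] in the target. *)
Lemma cvg_maps_into (f : cont_space Y X) (F : set_system (cont_space Y X)) :
  Filter F -> (forall p, maps_into p f -> F (maps_into p)) -> F --> f.
Proof.
move=> FF Ff N [_ [[V oV <-] Vf VN]]; rewrite nbhs_filterE.
apply: filterS VN _.
pose G : set_system {compact-open, Y -> X} := (fun g : cont_space Y X =>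
  g : Y -> X) @ F.
have : G --> (f : {compact-open, Y -> X}).
  apply/compact_open_cvgP => K O cK oO fKO.
  have cf : continuous f by exact: cts_fun.
  have [|||p Kp pO] := @interpolate _ _ hY cY oBY baseBY K (f @^-1` O).
  - exact: compact_closed.
  - by apply: open_comp => // x _; exact: cf.
  - by move=> y Ky; apply: fKO; exists y.
  have cfp : closed (f @` closure (basic_union BY p)).
    by apply: continuous_range_closed => //; exact: closed_closure.
  have fpO : f @` closure (basic_union BY p) `<=` O by move=> _ [y /pO Oy <-].
  have [q fq qO] := interpolate hX cX oBX baseBX cfp oO fpO.
  rewrite /G /= nbhs_filterE; apply: filterS (Ff (p, q) fq) => g /= gq.
  move=> _ [y Ky <-]; apply: qO; apply: subset_closure; apply: gq;
    exists y => //.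
  by apply: subset_closure; exact: Kp.
by apply; exact: open_nbhs_nbhs.
Qed.

End function_space.

Section zset_avoidance.
Context {Y X : topologicalType} (BY : nat -> set Y) (BX : nat -> set X).
Hypotheses (hY : hausdorff_space Y) (cY : compact [set: Y]).
Hypothesis oBY : forall i, open (BY i).
Hypothesis baseBY : forall U x, open U -> U x ->
  exists2 i, BY i x & BY i `<=` U.
Hypotheses (hX : hausdorff_space X) (cX : compact [set: X]).
Hypothesis oBX : forall i, open (BX i).
Hypothesis baseBX : forall U x, open U -> U x ->
  exists2 i, BX i x & BX i `<=` U.

(* A condition [(l, s)] says of a map [Y -> X] that it lies in the basic open
   set [boxes _ l] of the function space and has its range in the finite union
   coded by [s]. *)
Definition realizes (f : cont_space Y X)
    (c : seq (seq nat * seq nat) * seq nat) :=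
  boxes (maps_into BY BX) c.1 f /\ range f `<=` basic_union BX c.2.

Definition zset_cond : countType :=
  {c : seq (seq nat * seq nat) * seq nat | `[< exists f, realizes f c >]}.

Definition zset_region (c : zset_cond) : set X := basic_union BX (val c).2.

Definition zset_below (c c' : zset_cond) :=
  boxes (maps_into BY BX) (val c).1 `<=` boxes (maps_into BY BX) (val c').1 /\
  zset_region c `<=` zset_region c'.

Lemma zset_refine (c : zset_cond) (f : cont_space Y X) (U : set X) :
  boxes (maps_into BY BX) (val c).1 f -> open U -> range f `<=` U ->
  U `<=` zset_region c ->
  exists c' : zset_cond, [/\ zset_below c' c, closure (zset_region c') `<=` U &
    range f `<=` zset_region c'].
Proof.
move=> cf oU fU Uc.
have cfr : closed (range f).
  exact: (continuous_range_closed hX cY (@cts_fun _ _ f) (@closedT _)).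
have [s fs sU] := interpolate hX cX oBX baseBX cfr oU fU.
have v : `[< exists f, realizes f ((val c).1, s) >] by apply/asboolP; exists f.
exists (exist _ ((val c).1, s) v); split=> //; split=> //.
by apply: subset_trans Uc; apply: subset_trans sU; exact: subset_closure.
Qed.

Lemma zset_shrink c :
  exists2 c', zset_below c' c & closure (zset_region c') `<=` zset_region c.
Proof.
have /asboolP[f [cf fc]] := valP c.
have [c' [c'c cc' _]] := zset_refine cf (open_basic_union oBX _) fc
  (@subset_refl _ _).
by exists c'.
Qed.

Definition zset_avoidance : avoidance X :=
  @Avoidance X zset_cond zset_below zset_region
    (fun c => conj (@subset_refl _ _) (@subset_refl _ _))
    (fun b a c ab bc => conj (subset_trans ab.1 bc.1) (subset_trans ab.2 bc.2))
    (fun c c' h => h.2) (fun c => open_basic_union oBX _) zset_shrink.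

(** A map realising a condition whose region misses [A] has its range off [A], which gives density.
    Conversely the range of a map off [A] is compact, so a finite union of base sets around it has
    its closure off [A] and refines the condition. *)
Lemma zset_avoidedP A : closed A -> avoided zset_avoidance A <->
  dense [set f : cont_space Y X | range f `&` A = set0].
Proof.
move=> cA; split=> [aA O [f Of] oO|dA c].
  have [l fl lO] := subbase_boxes (cvg_maps_into hY cY oBY baseBY hX cX oBX
    baseBX) oO Of.
  have [s fs _] := interpolate hX cX oBX baseBX
    (continuous_range_closed hX cY (@cts_fun _ _ f) (@closedT _)) openT
      (@subsetT _ _).
  have v : `[< exists f, realizes f (l, s) >] by apply/asboolP; exists f.
  have [c' [/= ll _] Ac'] := aA (exist _ (l, s) v).
  have /asboolP[g [gc gr]] := valP c'; exists g; split; first exact/lO/ll.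
  rewrite /= -subset0 -Ac' => x [/gr xc' Ax]; split=> //.
  exact: subset_closure.
have /asboolP[f [cf fc]] := valP c.
have [||g [[cg gc] gA]] := dA (boxes (maps_into BY BX) (val c).1 `&`
    [set g : cont_space Y X | g @` setT `<=` zset_region c]).
- by exists f; split.
- apply: openI; first by apply: open_boxes; exact: open_maps_into.
  by apply: open_image_sub => //; exact: open_basic_union.
have [|||c' [c'c cc' _]] := @zset_refine c g (zset_region c `&` ~` A) cg.
- by apply: openI; [exact: open_basic_union|exact: closed_openC].
- move=> x gx; split; first exact: gc.
  by move=> Ax; suff : set0 x by []; rewrite -gA.
- exact: subIsetl.
exists c' => //.
by rewrite setIC; apply/disjoints_subset => x /cc'; case.
Qed.

(** A constant map at an interior point of [A] realises a condition with region inside [A]. Any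
    condition below it is realised by a map with values in [A], so its region meets [A]. *)
Lemma zset_thin : [set: Y] !=set0 -> thin zset_avoidance.
Proof.
move=> [y _] A [cA aA]; rewrite -subset0 => x Ax.
have xA : [set x] `<=` A° by move=> _ ->.
have [s xs sA] := interpolate hX cX oBX baseBX
  (accessible_closed_set1 (hausdorff_accessible hX) (x
    := x)) (@open_interior _ A) xA.
pose f : cont_space Y X := (cst x : continuousType Y X).
have v : `[< exists f, realizes f ([::], s) >].
  apply/asboolP; exists f; split=> // _ [z _ <-]; exact: xs.
have [c' [_ c's] Ac'] := aA (exist _ ([::], s) v).
have /asboolP[g [_ gr]] := valP c'; have gy : zset_region c' (g y) by apply:
  gr; exists y.
suff : set0 (g y) by []; rewrite -Ac'; split; last exact: subset_closure.
by apply: interior_subset; apply: sA; apply: subset_closure; exact: c's.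
Qed.

End zset_avoidance.

(** * Disjoint regions from a free coordinate of the cube *)

Section coordinate_spread.
Context {R : realType}.
Local Notation I := (set_type (@unit_interval R)).
Local Notation X := (cube R Omega).

Lemma unit_interval_disjoint_open : exists (t : nat -> I) (J : nat -> set I),
  [/\ forall k, open (J k), forall k, J k (t k) &
      forall k l, J k `&` J l !=set0 -> k = l].
Proof.
pose a k : R := (k.+1%:R^-1)%R.
have a0 k : (0 < a k)%R by rewrite invr_gt0.
have alt k : (a k.+1 < a k)%R by rewrite ltf_pV2 ?posrE// ltr_nat.
have ale k l : k <= l -> (a l <= a k)%R.
  by move=> kl; rewrite lef_pV2 ?posrE// ler_nat.
have a1 k : (a k <= 1)%R by have := ale 0 k (leq0n _); rewrite /a invr1.
pose mid k : R := ((a k.+1 + a k) / 2)%R.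
have midP k : (a k.+1 < mid k < a k)%R.
  by rewrite /mid; have := alt k; lra.
have mid01 k : (@unit_interval R) (mid k).
  rewrite /unit_interval /= in_itv /=; have := midP k; have := a0 k.+1.
  by have := a1 k; lra.
exists (fun k => SigSub (mem_set (mid01 k))).
exists (fun k => [set x : I | (a k.+1 < val x < a k)%R]); split=> [k|k|k l].
- exists (`](a k.+1), (a k)[%classic); first exact: itv_open.
  by apply/seteqP; split=> x /=; rewrite in_itv.
- exact: midP.
- move=> [x [/= /andP[kx xk] /andP[lx xl]]]; apply/eqP; rewrite eqn_leq.
  apply/andP; split; rewrite leqNgt; apply/negP.
    by move=> /ale; rewrite leNgt (lt_trans lx xk).
  by move=> /ale; rewrite leNgt (lt_trans kx xl).
Qed.

Lemma coord_open (J : set I) i : open J -> open [set x : X | J (x i)].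
Proof.
move=> oJ; apply: (@open_comp X I (fun x => x i) J) => // x _.
exact: (@proj_continuous _ (fun=> I) i).
Qed.

Lemma set_coord_eq (x : X) i t : set_coord x i t i = t.
Proof. by rewrite /set_coord eqxx. Qed.

Lemma set_coord_continuous (Y : topologicalType) (f : Y -> X) i t :
  continuous f -> continuous (fun y => set_coord (f y) i t).
Proof.
move=> cf y; apply: cvg_slab => q yq.
have [qi|qi] := eqVneq q.1 i.
  apply: filterS (@filterT _ (nbhs y) _) => z _ /=; move: yq.
  by rewrite /slab /= /set_coord qi eqxx.
have : nbhs y (f @^-1` slab q).
  apply: cf; apply: open_nbhs_nbhs; split; first exact: open_slab.
  by move: yq; rewrite /slab /= /set_coord (negPf qi).
by apply: filterS => z /=; rewrite /slab /= /set_coord (negPf qi).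
Qed.

Variable BX : nat -> set X.
Hypothesis oBX : forall i, open (BX i).
Hypothesis baseBX : forall U x, open U -> U x ->
  exists2 i, BX i x & BX i `<=` U.
Let hX : hausdorff_space X := @cube_hausdorff R Omega.
Let cX : compact [set: X] := @cube_compact R Omega.

Lemma base_spread (x0 : X) : spread (base_avoidance hX cX oBX baseBX x0).
Proof.
move=> c; have [t [J [oJ tJ dJ]]] := unit_interval_disjoint_open.
have [x cx] := base_region0 BX x0 c.
have [|N NP] := set_coord_compact (@compact_set1 _ x) (base_region_open oBX c).
  by move=> _ ->.
have /choice[s sP] k : exists j, BX j (set_coord x N (t k)) /\
    BX j `<=` base_region BX c `&` [set y | J k (y N)].
  have [||j ? ?] := @baseBX (base_region BX c `&` [set y | J k (y N)])
      (set_coord x N (t k)).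
  - by apply: openI; [exact: base_region_open|exact: coord_open].
  - by split; [exact: NP|rewrite /= set_coord_eq].
  - by exists j.
exists s; split=> [k|k l [y]] /=.
  by rewrite (base_regionE (sP k).1) => y /(proj2 (sP k))[].
rewrite (base_regionE (sP k).1) (base_regionE (sP l).1).
by move=> [/(proj2 (sP k))[_ yk] /(proj2 (sP l))[_ yl]]; apply: dJ;
  exists (y N).
Qed.

Context {Y : topologicalType} (BY : nat -> set Y).
Hypothesis cY : compact [set: Y].

Lemma boxes_set_coord (l : seq (seq nat * seq nat)) (f : cont_space Y X) :
  boxes (maps_into BY BX) l f ->
  exists N, forall i t (g : cont_space Y X), N <= i ->
    (forall y, g y = set_coord (f y) i t) -> boxes (maps_into BY BX) l g.
Proof.
elim: l => [|p l IHl]; first by exists 0.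
rewrite boxes_cons => -[fp /IHl[N NP]].
have Kc : compact (f @` closure (basic_union BY p.1)).
  apply: continuous_compact.
    by apply: continuous_subspaceT; exact: cts_fun.
  exact: (subclosed_compact (@closed_closure _ _) cY).
have [N' N'P] := set_coord_compact Kc (open_basic_union oBX _) fp.
exists (maxn N N') => i t g; rewrite geq_max => /andP[Ni N'i] gE.
split; last exact: NP Ni gE.
by move=> _ [y py <-]; rewrite gE; apply: N'P => //; exists y.
Qed.

(** Finitely many constraints on [f] survive the change of a far coordinate. Setting it to the
    constants [t k] gives maps with ranges in disjoint slices of the cube. *)
Lemma zset_spread : spread (@zset_avoidance _ _ BY BX cY hX cX oBX baseBX).
Proof.
move=> c; have [t [J [oJ tJ dJ]]] := unit_interval_disjoint_open.
have /asboolP[f [cf fc]] := valP c.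
have [N NP] := boxes_set_coord cf.
have Kc : compact (range f).
  apply: continuous_compact => //.
  by apply: continuous_subspaceT; exact: cts_fun.
have [N' N'P] := set_coord_compact Kc (open_basic_union oBX _) fc.
pose M := maxn N N'.
pose g k : cont_space Y X :=
  (mkcts (set_coord_continuous (i := M) (t
    := t k) (@cts_fun _ _ f)) : continuousType Y X).
have /choice[s sP] k : exists c', zset_below c' c /\
    closure (zset_region c') `<=` zset_region c `&` [set y | J k (y M)].
  have [||||c' [? ? _]] := @zset_refine _ _ BY BX cY hX cX oBX baseBX c (g k)
      (zset_region c `&` [set y | J k (y M)]).
  - by apply: (NP M (t k)) => //; exact: leq_maxl.
  - by apply: openI; [exact: open_basic_union|exact: coord_open].
  - move=> _ [y _ <-]; split; last by rewrite /= /g /= /mkcts set_coord_eq.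
    by apply: N'P; [exact: leq_maxr|exists y].
  - exact: subIsetl.
  - by exists c'.
exists s; split=> [k|k l [y [yk yl]]]; first exact: (sP k).1.
have [_ Jk] := (sP k).2 _ (subset_closure yk).
have [_ Jl] := (sP l).2 _ (subset_closure yl).
by apply: dJ; exists (y M).
Qed.

End coordinate_spread.

Local Open Scope ring_scope.

(** * Covering dimension *)

Section general_position.
Variables (R : realType).

Lemma exists_pos_nonroot (p : {poly R}) : p != 0 ->
  exists2 t, 0 < t & p.[t] != 0.
Proof.
move=> p0; apply: contrapT => nt.
have := @max_poly_roots _ p [seq (i.+1%:R : R) | i <- iota 0 (size p)] p0.
rewrite size_map size_iota ltnn => h; suff : false by []; apply: h.
  apply/allP => _ /mapP[i _ ->]; apply: contrapT => /negP ni.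
  by apply: nt; exists (i.+1%:R).
by rewrite map_inj_uniq ?iota_uniq// => i j /eqP; rewrite eqr_nat eqSS => /eqP.
Qed.

Lemma exists_normal n d (S : {set 'I_n}) (w : 'I_n -> 'I_d ->
  R) : (#|S| < d)%N ->
  exists b : 'I_d -> R, (exists i, b i != 0) /\
    forall k, k \in S -> \sum_i b i * w k i = 0.
Proof.
move=> Sd; pose A := \matrix_(i < d, j < #|S|) w (enum_val j) i.
have : kermx A != 0.
  rewrite kermx_eq0 /row_free; apply: contraTneq Sd => Ad.
  by rewrite -leqNgt -Ad rank_leq_col.
move=> /rowV0Pn[v /sub_kermxP vA v0]; exists (v 0); split.
  apply: contrapT => nv; move: v0; apply/negP; rewrite negbK;
    apply/eqP/rowP => i.
  by rewrite mxE; apply: contrapT => /eqP vi; apply: nv; exists i.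
move=> k kS; have /rowP/(_ (enum_rank_in kS k)) := vA.
rewrite !mxE => vA0; rewrite -[RHS]vA0; apply: eq_bigr => i _.
by rewrite mxE enum_rankK_in.
Qed.

(** The new vector is taken on the moment curve, with coordinates [t ^+ i] up to the prescribed
    signs. For each set of fewer than [d] earlier vectors it must stay off a hyperplane through
    them; a normal of this hyperplane turns the requirement into [t] not being a root of a nonzero
    polynomial. *)
Lemma general_position d (sg : nat -> 'I_d -> bool) n :
  exists w : nat -> 'I_d -> R,
    (forall k i, if sg k i then 0 < w k i else w k i < 0) /\
    forall S : {set 'I_n}, (#|S| <= d)%N -> forall a : 'I_n -> R,
      (forall i, \sum_(k in S) a k * w k i = 0) -> forall k, k \in S -> a k = 0.
Proof.
elim: n => [|n [w [wsg wli]]].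
  exists (fun k i => if sg k i then 1 else - 1); split;
    last by move=> S _ a _ [].
  by move=> k i; case: (sg k i); rewrite ?ltrN10 ?ltr01.
pose s i : R := if sg n i then 1 else - 1.
have s0 i : s i != 0 by rewrite /s; case: ifP => _; rewrite ?oppr_eq0 oner_eq0.
have /choice[b bP] (S : {set 'I_n}) : exists b : 'I_d -> R, (#|S| < d)%N ->
    (exists i, b i != 0) /\ forall k, k \in S -> \sum_i b i * w k i = 0.
  have [Sd|] := boolP (#|S| < d)%N; last by exists (fun=> 0).
  by have [b bP] := exists_normal (fun k : 'I_n => w k) Sd; exists b.
pose p (S : {set 'I_n}) : {poly R} := if (#|S| < d)%N
  then \sum_(i < d) (b S i * s i) *: 'X^i else 1.
have pE (S : {set 'I_n}) (i : nat) : (#|S| < d)%N ->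
  (p S)`_i = if insub i is Some j then b S j * s j else 0.
  move=> Sd; rewrite /p Sd coef_sum; case: insubP => [j _ ji|].
    rewrite (bigD1 j)//= coefZ coefXn ji eqxx mulr1 big1 ?addr0// => k kj.
    rewrite coefZ coefXn; case: eqP => [ik|]; last by rewrite mulr0.
    by move: kj; rewrite -val_eqE /= ji ik eqxx.
  rewrite -leqNgt => di; apply: big1 => k _; rewrite coefZ coefXn.
  by case: eqP => [ik|]; [have := ltn_ord k; rewrite -ik ltnNge di|rewrite
    mulr0].
have p0 (S : {set 'I_n}) : p S != 0.
  have [Sd|nSd] := boolP (#|S| < d)%N; last by rewrite /p (negPf nSd) oner_eq0.
  have [[i bi] _] := bP _ Sd; apply/eqP => pS; have := pE S i Sd.
  by rewrite pS coef0 valK => /esym/eqP; rewrite mulf_eq0 (negPf bi) (negPf (s0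
    i)).
have [|t t0 pt] := @exists_pos_nonroot (\prod_S p S).
  by apply/prodf_neq0 => S _.
pose w' k i := if k == n then s i * t ^+ i else w k i.
have w'n i : w' n i = s i * t ^+ i by rewrite /w' eqxx.
have w'k (k : 'I_n) i : w' k i = w k i by rewrite /w' ltn_eqF.
exists w'; split=> [k i|S Sd a aS].
  rewrite /w'; case: eqP => [->|_]; last exact: wsg.
  by rewrite /s; case: (sg n i); rewrite ?mul1r ?mulN1r ?oppr_lt0 exprn_gt0.
pose S' : {set 'I_n} := [set k : 'I_n | widen_ord (leqnSn n) k \in S]%SET.
have inS' k : (k \in S') = (widen_ord (leqnSn n) k \in S) by rewrite /S' inE.
pose a' k := a (widen_ord (leqnSn n) k).
have sumS (F : nat -> R) : \sum_(k in S) a k * F k =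
    \sum_(k in S') a' k * F k + (if ord_max \in S then a ord_max * F n else 0).
  rewrite big_mkcond big_ord_recr /= [in RHS]big_mkcond; congr (_ + _).
  by apply: eq_bigr => k _; rewrite inS'.
have cardS : #|S| = (#|S'| + (ord_max \in S))%N.
  rewrite -!sum1_card big_mkcond big_ord_recr /= [in RHS]big_mkcond;
    congr (_ + _)%N.
  by apply: eq_bigr => k _; rewrite inS'.
have aS' i : \sum_(k in S') a' k * w k i +
    (if ord_max \in S then a ord_max * (s i * t ^+ i) else 0) = 0.
  rewrite -[RHS](aS i) (sumS (fun k => w' k i)) w'n; congr (_ + _).
  by apply: eq_bigr => k _; rewrite w'k.
have amax : ord_max \in S -> a ord_max = 0.
  move=> nS; have S'd : (#|S'| < d)%N by move: Sd; rewrite cardS nS addn1.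
  have [_ bw] := bP _ S'd.
  have : \sum_i b S' i * (\sum_(k in S') a' k * w k i + a ord_max * (s i * t ^+
    i)) = 0.
    by apply: big1 => i _; have := aS' i; rewrite nS => ->; rewrite mulr0.
  under eq_bigr do rewrite mulrDr.
  rewrite big_split /= [X in X + _](_ : _ = 0) ?add0r; last first.
    under eq_bigr do rewrite mulr_sumr.
    rewrite exchange_big /=; apply: big1 => k kS'.
    under eq_bigr do rewrite mulrCA.
    by rewrite -mulr_sumr bw// mulr0.
  under eq_bigr do rewrite mulrCA.
  rewrite -mulr_sumr => /eqP; rewrite mulf_eq0 => /orP[/eqP//|/eqP sum0].
  move: pt; rewrite horner_prod (bigD1 S')//= mulf_eq0 negb_or => /andP[+ _].
  rewrite /p S'd horner_sum; under eq_bigr do rewrite hornerZ hornerXn.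
  by under eq_bigr do rewrite -mulrA; rewrite sum0 eqxx.
have a'0 k : k \in S' -> a' k = 0.
  apply: wli; first by apply: leq_trans Sd; rewrite cardS leq_addr.
  move=> i; have := aS' i; case: ifP => [/amax ->|_]; last by rewrite addr0.
  by rewrite mul0r addr0.
move=> k; have [kn|kn] := eqVneq k ord_max; first by rewrite kn; exact: amax.
have kltn : (k < n)%N.
  by have := ltn_ord k; rewrite ltnS leq_eqVlt -[k == n :> nat]/(k == ord_max)
    (negPf kn).
have kE : k = widen_ord (leqnSn n) (Ordinal kltn) by exact: val_inj.
by rewrite kE => kS; apply: a'0; rewrite inS'.
Qed.

End general_position.

Section urysohn_function.
Context {R : realType} {X : topologicalType}.
Hypotheses (hX : hausdorff_space X) (cX : compact [set: X]).

Lemma urysohn_function (A B : set X) : closed A -> closed B -> A `&` B = set0 ->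
  exists f : X -> R, [/\ continuous f, forall x, 0 <= f x <= 1,
    forall x, A x -> f x = 0 & forall x, B x -> f x = 1].
Proof.
move=> cA cB AB.
have /(uniform_separatorP (R := R))[f [cf f01 fA fB]] :=
  normal_uniform_separator (compact_normal hX cX) cA cB AB.
exists f; split=> // [x|x Ax|x Bx].
- by have := f01 (f x) (ex_intro2 _ _ x I erefl); rewrite /= in_itv.
- by apply: fA; exists x.
- by apply: fB; exists x.
Qed.

Lemma closed_sublevel (f : X -> R) a : continuous f ->
  closed [set x | f x <= a].
Proof. by move=> cf; exact: (preimage_closed (fun x _ =>
  cf x) (@closed_le _ a)). Qed.

Lemma closed_superlevel (f : X -> R) a : continuous f ->
  closed [set x | a <= f x].
Proof. by move=> cf; exact: (preimage_closed (fun x _ =>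
  cf x) (@closed_ge _ a)). Qed.

End urysohn_function.

(** * The Eilenberg-Otto criterion as a poset of conditions *)

Section sep_avoidance.
Context {R : realType} {X : topologicalType} (B : nat -> set X) (m : nat).
Hypotheses (hX : hausdorff_space X) (cX : compact [set: X]).
Hypothesis oB : forall i, open (B i).
Hypothesis baseB : forall U x, open U -> U x -> exists2 i, B i x & B i `<=` U.

Let clU s := closure (basic_union B s).

(* A condition is a family of [m + 1] pairs of open sets with disjoint closures.
   Its region is what the two sides of all pairs leave uncovered, so a set is
   avoided exactly when it satisfies the Eilenberg-Otto criterion for having
   dimension at most [m]. *)
Definition sep_cond : countType :=
  {c : {ffun 'I_m.+1 -> seq nat * seq nat} |
    `[< forall i, closure (basic_union B (c i).1) `&`
                  closure (basic_union B (c i).2) = set0 >]}.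

Definition sep_left (c : sep_cond) i := basic_union B (val c i).1.
Definition sep_right (c : sep_cond) i := basic_union B (val c i).2.

Lemma sep_disjoint (c : sep_cond) i :
  closure (sep_left c i) `&` closure (sep_right c i) = set0.
Proof. by have /asboolP := valP c; apply. Qed.

Definition sep_below (c c' : sep_cond) := forall i,
  sep_left c' i `<=` sep_left c i /\ sep_right c' i `<=` sep_right c i.

Definition sep_region (c : sep_cond) : set X :=
  \bigcap_i ~` (closure (sep_left c i) `|` closure (sep_right c i)).

Lemma sep_region_open c : open (sep_region c).
Proof.
rewrite /sep_region -setC_bigcup; apply: closed_openC.
apply: closed_bigcup => [|i _]; first exact: finite_finset.
by apply: closedU; exact: closed_closure.
Qed.

Lemma sep_regionS c c' : sep_below c' c -> sep_region c' `<=` sep_region c.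
Proof.
move=> c'c x xc' i _ [xi|xi]; apply: (xc' i) => //; [left|right];
  by apply: closureS xi; have [] := c'c i.
Qed.

Lemma sep_exists (P N : 'I_m.+1 -> set X) : (forall i, closed (P i)) ->
  (forall i, closed (N i)) -> (forall i, P i `&` N i = set0) ->
  exists c : sep_cond, forall i, P i `<=` sep_left c i /\ N i `<=` sep_right c
    i.
Proof.
move=> cP cN PN.
have /choice[p pP] i : exists p, P i `<=` basic_union B p /\ clU p `<=` ~` N i.
  have [|p Pp pN] := interpolate hX cX oB baseB (cP i) (closed_openC (cN i)).
    exact/disjoints_subset.
  by exists p.
have /choice[q qP] i : exists q, N i `<=` basic_union B q /\ clU q `<=` ~` clU
  (p i).
  have [|q Nq qp] := interpolate hX cX oB baseB (cN i)
    (closed_openC (@closed_closure _ (basic_union B (p i)))).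
    by apply/disjoints_subset; rewrite setIC; apply/disjoints_subset;
      exact: (pP i).2.
  by exists q.
have v : `[< forall i, closure (basic_union B ([ffun i => (p i, q i)] i).1) `&`
    closure (basic_union B ([ffun i => (p i, q i)] i).2) = set0 >].
  apply/asboolP => i; rewrite ffunE /= setIC; apply/disjoints_subset.
  exact: (qP i).2.
exists (exist _ [ffun i => (p i, q i)] v) => i.
by rewrite /sep_left /sep_right /= ffunE; split;
  [exact: (pP i).1|exact: (qP i).1].
Qed.

Lemma sep_shrink c :
  exists2 c', sep_below c' c & closure (sep_region c') `<=` sep_region c.
Proof.
have [c' c'P] := sep_exists (fun i => @closed_closure _ _)
  (fun i => @closed_closure _ _) (sep_disjoint c).
exists c' => [i|x xc' i _ [xi|xi]].
- by split; apply: subset_trans (@subset_closure _ _) _; have [] := c'P i.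
- have : closure (~` sep_left c' i) x.
    apply: closureS xc' => y /(_ i I) /not_orP[yl _].
    by apply: contra_not yl; exact: subset_closure.
  rewrite -(closure_id _).1; first by apply; exact: (c'P i).1.
  by apply: open_closedC; exact: open_basic_union.
- have : closure (~` sep_right c' i) x.
    apply: closureS xc' => y /(_ i I) /not_orP[_ yr].
    by apply: contra_not yr; exact: subset_closure.
  rewrite -(closure_id _).1; first by apply; exact: (c'P i).2.
  by apply: open_closedC; exact: open_basic_union.
Qed.

Lemma sep_below_trans c' c c'' :
  sep_below c c' -> sep_below c' c'' -> sep_below c c''.
Proof.
by move=> h h' i; split; [apply: subset_trans (h i).1; exact: (h' i).1|
  apply: subset_trans (h i).2; exact: (h' i).2].
Qed.

Definition sep_avoidance : avoidance X :=
  @Avoidance X sep_cond sep_below sep_region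
    (fun c i => conj (@subset_refl _ _) (@subset_refl _ _))
    sep_below_trans sep_regionS sep_region_open sep_shrink.

(** A function [h] separating the two sides of the first pair cuts out disjoint strips: the k-th
    condition absorbs the points with [h] at most 1/(k+2) into the left side and those with [h] at
    least 1/(k+1) into the right side, so its region lies strictly between. *)
Lemma sep_spread : spread sep_avoidance.
Proof.
move=> c; have [h [ch h01 h0 h1]] := @urysohn_function R _ hX cX _ _
  (@closed_closure _ (sep_left c ord0)) (@closed_closure _ (sep_right c ord0))
  (sep_disjoint c ord0).
pose a k : R := k.+1%:R^-1.
have a0 k : 0 < a k by rewrite invr_gt0.
have alt k : a k.+1 < a k by rewrite ltf_pV2 ?posrE// ltr_nat.
have ale k l : (k <= l)%N -> a l <= a k.
  by move=> kl; rewrite lef_pV2 ?posrE// ler_nat.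
have a1 k : a k <= 1 by have := ale 0%N k (leq0n _); rewrite /a invr1.
pose P k i := if i == ord0 then [set x | h x <= a k.+1] else closure (sep_left
  c i).
pose N k i := if i == ord0 then [set x | a k <= h x] else closure (sep_right c
  i).
have /choice[s sP] k : exists c' : sep_cond, forall i,
    P k i `<=` sep_left c' i /\ N k i `<=` sep_right c' i.
  apply: sep_exists => i; rewrite /P /N; case: eqP => _.
  - exact: closed_sublevel.
  - exact: closed_closure.
  - exact: closed_superlevel.
  - exact: closed_closure.
  - rewrite -subset0 => x [/= xk kx]; have := le_trans kx xk.
    by rewrite leNgt alt.
  - exact: sep_disjoint.
have below_s k : sep_below (s k) c.
  move=> i; have [Ps Ns] := sP k i.
  split; [apply: subset_trans Ps|apply: subset_trans Ns]; rewrite /P /N;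
    case: eqP => [->|_] x xc; try exact: subset_closure.
  - by rewrite /= h0 ?ltW//; exact: subset_closure.
  - by rewrite /= h1//; exact: subset_closure.
have regS k x : sep_region (s k) x -> a k.+1 < h x < a k.
  move=> /(_ ord0 I)/not_orP[nl nr]; have [Ps Ns] := sP k ord0.
  apply/andP; split; rewrite ltNge; apply/negP => hx.
    by apply: nl; apply: subset_closure; apply: Ps.
  by apply: nr; apply: subset_closure; apply: Ns.
exists s; split=> [k|k l]; first exact: below_s.
move=> [x [/regS/andP[kx xk] /regS/andP[lx xl]]]; apply/eqP; rewrite eqn_leq.
apply/andP; split; rewrite leqNgt; apply/negP.
  by move=> /ale; rewrite leNgt (lt_trans lx xk).
by move=> /ale; rewrite leNgt (lt_trans kx xl).
Qed.

(** The sets where [G i] is at least [eps] and at most [- eps] lie in the sides of a condition, and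
    the closed sides of some condition below cover [A]. Adding to [G i] a function equal to [eps] on
    the left and [- eps] on the right removes the common zeros: a zero on the left would have
    [G i x = - eps] and so lie on the right. *)
Lemma avoided_perturb (A : set X) (G : 'I_m.+1 -> X -> R) (eps : R) : 0 < eps ->
  avoided sep_avoidance A -> (forall i, continuous (G i)) ->
  exists G' : 'I_m.+1 -> X -> R, [/\ forall i, continuous (G' i),
    forall i x, `|G' i x - G i x| <= eps + eps &
    forall x, A x -> exists i, G' i x != 0].
Proof.
move=> e0 aA cG.
have [c cP] : exists c : sep_cond, forall i,
  [set x | eps <= G i x] `<=` sep_left c i /\
    [set x | G i x <= - eps] `<=` sep_right c i.
  apply: sep_exists => i.
  - exact: closed_superlevel.
  - exact: closed_sublevel.
  - by rewrite -subset0 => x [/= ]; lra.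
have [c' c'c Ac'] := aA c.
have /choice[h hP] i : exists f : X ->
  R, [/\ continuous f, forall x, 0 <= f x <= 1,
    forall x, closure (sep_right c' i) x -> f x = 0 &
    forall x, closure (sep_left c' i) x -> f x = 1].
  apply: urysohn_function => //; try exact: closed_closure.
  by rewrite setIC; exact: sep_disjoint.
exists (fun i x => G i x + eps * (h i x + h i x - 1)); split=> [i x|i x|x Ax].
- have [ch _ _ _] := hP i.
  apply: cvgD; first exact: cG.
  apply: cvgM; first exact: cvg_cst.
  by apply: cvgB; [apply: cvgD; exact: ch|exact: cvg_cst].
- have [_ /(_ x) h01 _ _] := hP i.
  rewrite addrC addKr ler_norml; nra.
- apply: contrapT => nA.
  have Gx0 i : G i x + eps * (h i x + h i x - 1) = 0.
    by apply: contrapT => /eqP nG; apply: nA; exists i.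
  suff xr : sep_region c' x.
    by suff : set0 x by []; rewrite -Ac'; split=> //; exact: subset_closure.
  move=> i _ [xl|xr]; have [_ _ hr hl] := hP i; have := Gx0 i.
    rewrite (hl _ xl) => Gx.
    have Gle : G i x <= - eps by lra.
    suff : set0 x by []; rewrite -(sep_disjoint c' i); split=> //.
    by apply: subset_closure; apply: (c'c i).2; apply: (cP i).2.
  rewrite (hr _ xr) => Gx.
  have Gle : eps <= G i x by lra.
  suff : set0 x by []; rewrite -(sep_disjoint c' i); split=> //.
  by apply: subset_closure; apply: (c'c i).1; apply: (cP i).1.
Qed.

End sep_avoidance.

Lemma finite_enumeration (T : Type) (C : set (set T)) : finite_set C ->
  exists n (U : nat -> set T), [/\ forall i, (i < n)%N -> C (U i),
    forall W, C W -> exists2 i, (i < n)%N & U i = W &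
    forall i j, (i < n)%N -> (j < n)%N -> U i = U j -> i = j].
Proof.
move=> [n]; rewrite card_eq_sym => /card_set_bijP[U [UC Uinj Usurj]].
exists n, U; split=> [i ?|W /Usurj[i ? <-]|i j ? ?]; first exact: UC.
  by exists i.
by apply: Uinj; rewrite inE.
Qed.

Lemma continuous_sumr (R : realType) (T : topologicalType) (J : Type) (r : seq
  J)
    (P : pred J) (F : J -> T -> R) : (forall j, continuous (F j)) ->
  continuous (fun x => \sum_(j <- r | P j) F j x).
Proof.
move=> cF; apply: continuous_big => [|j _]; last exact: cF.
by move=> z; apply: cvgD; [exact: cvg_fst|exact: cvg_snd].
Qed.

(** * Equivalence of the criterion with covering dimension *)

Section dimension.
Context {R : realType} {X : topologicalType} (B : nat -> set X) (m : nat).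
Hypotheses (hX : hausdorff_space X) (cX : compact [set: X]).
Hypothesis oB : forall i, open (B i).
Hypothesis baseB : forall U x, open U -> U x -> exists2 i, B i x & B i `<=` U.

Lemma subordinate_functions (A : set X) n (V : nat -> set X) : closed A ->
  (forall i, (i < n)%N -> open (V i)) ->
  A `<=` \bigcup_(i in [set i | (i < n)%N]) V i ->
  exists phi : nat -> X -> R, [/\ forall i, continuous (phi i),
    forall i x, 0 <= phi i x <= 1,
    forall i x, (i < n)%N -> phi i x != 0 -> V i x &
    forall x, A x -> exists2 i, (i < n)%N & phi i x = 1].
Proof.
move=> cA oV AV.
pose good b := exists2 i, (i < n)%N & closure (B b) `<=` V i.
have [||N AN] := @compact_nat_cover _ A (fun b =>
  if `[< good b >] then B b else set0)
    (subclosed_compact cA cX (@subsetT _ _)).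
- by move=> b; case: ifP => _ //; exact: open0.
- move=> x /AV[i /= ilt Vx].
  have [b Bx cB] := base_regular hX cX baseB (oV i ilt) Vx.
  by exists b => //; rewrite asboolT//; exists i.
pose s i := [seq b <- iota 0 N | `[< closure (B b) `<=` V i >]].
pose K i := \bigcup_(b in [set` s i]) closure (B b).
have cK i : closed (K i).
  by apply: closed_bigcup => [|b _]; [exact: finite_seq|exact: closed_closure].
have KV i : K i `<=` V i by move=> x [b /=]; rewrite mem_filter =>
  /andP[/asboolP + _]; apply.
have /choice[phi phiP] i : exists f : X -> R, (i < n)%N ->
    [/\ continuous f, forall x, 0 <= f x <= 1,
      forall x, (~` V i) x -> f x = 0 & forall x, K i x -> f x = 1].
  have [ilt|] := boolP (i < n)%N; last by exists (fun=> 0).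
  have [||f fP] := @urysohn_function R _ hX cX (~` V i) (K i) _ (cK i).
  - by apply: open_closedC; exact: oV.
  - by rewrite setIC; apply/disjoints_subset; rewrite setCK.
  - by exists f.
exists (fun i => if (i < n)%N then phi i else fun=> 0);
  split=> [i|i x|i x ilt|x Ax].
- case: ifP => [ilt|_]; first by have [] := phiP i ilt.
  by move=> x; exact: cvg_cst.
- case: ifP => [ilt|_]; first by have [_ /(_ x)] := phiP i ilt.
  by rewrite lexx ler01.
- rewrite ilt => nz; apply: contrapT => nV; have [_ _ /(_ x nV) f0 _]
  := phiP i ilt.
  by move: nz; rewrite f0 eqxx.
- have [b /= bN] := AN x Ax; case: asboolP => // -[i ilt bV] Bx.
  exists i => //; rewrite ilt; have [_ _ _ ->//] := phiP i ilt.
  exists b; last exact: subset_closure.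
  by rewrite /= mem_filter asboolT//= mem_iota.
Qed.

Lemma compact_margin (A : set X) (J : finType) (G : J -> X -> R) : closed A ->
  (forall j, continuous (G j)) -> (forall x, A x -> exists j, G j x != 0) ->
  exists2 d : R, 0 < d & forall x, A x -> exists j, d <= `|G j x|.
Proof.
move=> cA cG AG; pose a k : R := k.+1%:R^-1.
have a0 k : 0 < a k by rewrite invr_gt0.
have ale k l : (k <= l)%N -> a l <= a k by move=> kl;
  rewrite lef_pV2 ?posrE// ler_nat.
have [||k l kl|k Ak] := @compact_nat_homo _ A (fun k =>
  \bigcup_j [set x | a k < `|G j x|])
    (subclosed_compact cA cX (@subsetT _ _)).
- move=> k; apply: bigcup_open => j _.
  rewrite (_ : [set x | _] = (fun x => `|G j x|) @^-1` `]a k, +oo[%classic).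
    apply: open_comp; last exact: rray_open.
    by move=> x _; apply: (@continuous_comp _ _ _ (G j) Num.norm);
      [exact: cG|exact: norm_continuous].
  by apply/seteqP; split=> x /=; rewrite in_itv/= andbT.
- move=> x /AG[j Gx].
  exists (Num.truncn (`|G j x|^-1)) => //; exists j => //=.
  rewrite invf_plt ?posrE ?normr_gt0//.
  by have := truncnS_gt `|G j x|^-1; rewrite pmulrn.
- by move=> x [j _ /= lx]; exists j => //=; exact: le_lt_trans (ale _ _ kl) lx.
- by exists (a k) => // x /Ak[j _ /= jx]; exists j; exact: ltW.
Qed.

Section perturbation.
Variables (A : set X) (n : nat).
Hypotheses (cA : closed A) (aA : avoided (@sep_avoidance X B m hX cX oB baseB)
  A).

Definition separating (phi : 'I_n -> X -> R) (tau : {ffun 'I_m.+2 -> 'I_n}) :=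
  forall x, A x -> exists i j, phi (tau i) x != phi (tau j) x.

Lemma separating_stable (phi : 'I_n -> X -> R) (l : seq {ffun 'I_m.+2 ->
  'I_n}) :
  (forall k, continuous (phi k)) -> (forall tau, tau \in l ->
    separating phi tau) ->
  exists2 d : R, 0 < d & forall psi : 'I_n -> X -> R,
    (forall k x, `|psi k x - phi k x| <= d) ->
    forall tau, tau \in l -> separating psi tau.
Proof.
move=> cphi; elim: l => [|tau l IHl] sl; first by exists 1.
have [d d0 dP] : exists2 d : R, 0 < d & forall psi : 'I_n -> X -> R,
    (forall k x, `|psi k x - phi k x| <= d) ->
    forall tau, tau \in l -> separating psi tau.
  by apply: IHl => tau' tl; apply: sl; rewrite inE tl orbT.
have [||e e0 eP] := @compact_margin A ('I_m.+2 * 'I_m.+2)%type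
  (fun p x => phi (tau p.1) x - phi (tau p.2) x) cA.
- by move=> p x; apply: cvgB; exact: cphi.
- move=> x Ax; have [|i [j ij]] := sl tau _ x Ax; first by rewrite inE eqxx.
  by exists (i, j); rewrite subr_eq0.
(* Two functions moving by at most [e / 3] each cannot cancel a difference of size at least [e]. *)
exists (Num.min d (e / 3)); first by rewrite lt_min d0 divr_gt0.
move=> psi psiP tau'; rewrite inE => /predU1P[->|tl]; last first.
  by apply: dP => // k x; have := psiP k x; rewrite le_min => /andP[].
move=> x Ax; have [[i j] /= ij] := eP x Ax; exists i, j.
have := psiP (tau i) x; have := psiP (tau j) x.
rewrite !le_min => /andP[_ +] /andP[_ +]; rewrite !ler_norml => xj xi.
by apply/eqP => ijE; move: ij; rewrite ler_normr; lra.
Qed.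

(** The tuples are treated one by one, each perturbation being too small to undo the others. For
    [tau] the [m + 1] differences from the function at [tau ord0] are perturbed so as to have no
    common zero on [A]. *)
Lemma perturb_separating (l : seq {ffun 'I_m.+2 -> 'I_n}) (phi : 'I_n -> X -> R)
    (eps : R) : 0 < eps -> (forall tau, tau \in l -> injective tau) ->
  (forall k, continuous (phi k)) ->
  exists psi : 'I_n -> X -> R, [/\ forall k, continuous (psi k),
    forall k x, `|psi k x - phi k x| <= eps &
    forall tau, tau \in l -> separating psi tau].
Proof.
elim: l eps => [|tau l IHl] eps e0 linj cphi.
  by exists phi; split=> // k x; rewrite subrr normr0 ltW.
have [|||psi [cpsi psie psil]] := IHl (eps / 2).
- by rewrite divr_gt0.
- by move=> tau' tl; apply: linj; rewrite inE tl orbT.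
- exact: cphi.
have tinj : injective tau by apply: linj; rewrite inE eqxx.
have [d d0 dP] := separating_stable cpsi psil.
pose e := Num.min d (eps / 2).
have ee0 : 0 < e by rewrite lt_min d0 divr_gt0.
(* Each of the [m + 1] differences moves by at most [e' + e'], which adds up to [e]. *)
pose e' := e / (m.+1%:R * 2).
have e'0 : 0 < e' by rewrite divr_gt0// mulr_gt0.
pose G i x := psi (tau (lift ord0 i)) x - psi (tau ord0) x.
have cG i : continuous (G i) by move=> x; apply: cvgB; exact: cpsi.
have [G' [cG' G'G G'0]] := avoided_perturb e'0 aA cG.
pose psi' k x := psi k x + \sum_(i < m.+1 | k == tau (lift ord0 i)) (G' i x - G
  i x).
have psi'E k x : `|psi' k x - psi k x| <= e.
  rewrite addrC addKr; apply: le_trans (ler_norm_sum _ _ _) _.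
  rewrite big_mkcond /=; apply: (@le_trans _ _ (\sum_(i < m.+1) (e' + e'))).
    apply: ler_sum => i _; case: ifP => _; first exact: G'G.
    by rewrite addr_ge0 ?ltW.
  rewrite sumr_const card_ord -mulr_natl /e' le_eqVlt; apply/orP; left;
    apply/eqP.
  have : (m.+1%:R : R) != 0 by rewrite pnatr_eq0.
  by move: (m.+1%:R : R) => M M0; field.
exists psi'; split.
- move=> k x; apply: cvgD; first exact: cpsi.
  apply: continuous_sumr => i y; apply: cvgB; first exact: cG'.
  exact: cG.
- move=> k x; have := psi'E k x; have := psie k x.
  rewrite /e le_min => h1 /andP[_ h2].
  rewrite (_ : psi' k x - phi k x = (psi' k x - psi k x) + (psi k x - phi k
    x)); last lra.
  by apply: le_trans (ler_normD _ _) _; lra.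
- move=> tau'; rewrite inE => /predU1P[->|]; last first.
    by apply: dP => k x; have := psi'E k x; rewrite le_min => /andP[].
  move=> x Ax; have [i G'i] := G'0 x Ax; exists (lift ord0 i), ord0.
  rewrite -subr_eq0 (_ : psi' _ x - _ = G' i x)//.
  rewrite /psi' (big_pred1 i) => [|j]; last first.
    by rewrite /= (inj_eq tinj) (inj_eq lift_inj).
  rewrite big_pred0 => [|j]; last by rewrite (inj_eq tinj) -val_eqE.
  by rewrite /G addr0; lra.
Qed.

End perturbation.

Lemma open_set_typeP (A : set X) (U : set A) : open U ->
  exists2 V : set X, open V & val @^-1` V = U.
Proof. by move=> [V oV <-]; exists V. Qed.

(* The members of a partition-like family [psi] whose value exceeds all but [m]
   others cover, because no [m + 2] of them agree at a point of [A]. *)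
Lemma avoided_covering_dim (A : set X) : closed A ->
  avoided (@sep_avoidance X B m hX cX oB baseB) A -> covering_dim_le A m.
Proof.
move=> cA aA C /finite_enumeration[n [U [UC CU _]]] [Co CT].
have /choice[V VP] i : exists V : set X, (i < n)%N ->
  open V /\ val @^-1` V = U i.
  have [ilt|] := boolP (i < n)%N; last by exists setT.
  by have [V oV VU] := open_set_typeP (Co _ (UC i ilt)); exists V.
have [||phi [cphi _ phiV phi1]] := @subordinate_functions A n V cA.
- by move=> i /VP[].
- move=> x Ax; pose x' : A := SigSub (mem_set Ax).
  have : (\bigcup_(W in C) W) x' by rewrite CT.
  move=> [W /CU[i ilt <-] Ux]; exists i => //.
  by have [_ VU] := VP i ilt; move: Ux; rewrite -VU.
(* With errors of at most [1 / 4] the largest [psi] exceeds [1 / 2] on [A], and where [psi i]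
   exceeds [1 / 2] the function [phi i] is nonzero. *)
have q0 : 0 < 1 / 4 :> R by lra.
have [||psi [cpsi psiphi psisep]] := @perturb_separating A n cA aA
  (enum [pred tau : {ffun 'I_m.+2 -> 'I_n} | injectiveb tau])
  (fun k : 'I_n => phi k) (1 / 4) q0.
- by move=> tau; rewrite mem_enum => /injectiveP.
- by move=> k; exact: cphi.
pose above i x := [pred j : 'I_n | psi i x <= psi j x].
pose W i : set X := [set x | 1 / 2 < psi i x /\ (#|above i x| <= m.+1)%N].
have oW i : open (W i).
  rewrite openE => x [xi xm].
  have nlt (f : X -> R) a : continuous f -> a < f x ->
    \forall y \near x, a < f y.
    move=> cf af; have : nbhs x (f @^-1` `]a, +oo[%classic).
      apply: cf; apply: open_nbhs_nbhs; split; first exact: rray_open.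
      by rewrite /= in_itv/= af.
    by apply: filterS => y /=; rewrite in_itv/= andbT.
  have n1 := nlt _ _ (cpsi i) xi.
  have n2 : \forall y \near x, forall j, psi j x < psi i x -> psi j y < psi i y.
    apply: filter_forall => j.
    have [ji|] := boolP (psi j x < psi i x); last by move=> _; apply: filterE.
    have ij0 : 0 < psi i x - psi j x by rewrite subr_gt0.
    have cij : continuous (fun x => psi i x - psi j x).
      by move=> y; apply: cvgB; exact: cpsi.
    have := nlt _ _ cij ij0; apply: filterS => y yij _.
    by rewrite -subr_gt0.
  apply: filterS2 n1 n2 => y y1 y2; split=> //; apply: leq_trans xm.
  apply: subset_leq_card; apply/fintype.subsetP => j; rewrite !inE !leNgt.
  by apply: contra => /y2.
exists (range (fun i => val @^-1` W i : set A)); split.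
- by apply: finite_image; exact: finite_finset.
- split; first by move=> _ [i _ <-]; exists (W i) => //; exact: oW.
  apply/seteqP; split=> // x _; have Ax := set_valP x.
  have [k klt phik] := phi1 _ Ax.
  have [i imax] : exists i, forall j, psi j (val x) <= psi i (val x).
    pose i0 : 'I_n := Ordinal klt.
    by case: (@arg_maxP _ _ _ i0 xpredT (fun j => psi j (val x)) isT) =>
      i _ imax;
      exists i => j; exact: imax.
  have psii : 1 / 2 < psi i (val x).
    have := imax (Ordinal klt); have := psiphi (Ordinal klt) (val x).
    by rewrite /= phik ler_norml; lra.
  exists (val @^-1` W i); [by exists i|split=> //].
  rewrite leqNgt; apply/negP => mi.
  pose tau := [ffun k : 'I_m.+2 => enum_val (widen_ord mi k)].
  have tau_inj : injective tau.
    by move=> a b; rewrite !ffunE => /enum_val_inj/(congr1 val) /= /val_inj.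
  have tauE a : psi (tau a) (val x) = psi i (val x).
    apply/eqP; rewrite eq_le imax /= ffunE.
    by have := enum_valP (widen_ord mi a); rewrite inE.
  have tau_in : tau \in enum [pred tau : {ffun 'I_m.+2 ->
    'I_n} | injectiveb tau].
    by rewrite mem_enum inE; apply/injectiveP.
  have [a [b]] := psisep tau tau_in _ Ax.
  by rewrite !tauE eqxx.
- move=> _ [i _ <-]; have ilt := ltn_ord i; exists (U i); first exact: UC.
  have [_ <-] := VP i ilt; move=> x [xi _]; apply: phiV => //.
  have := psiphi i (val x); rewrite ler_norml => h.
  by apply/eqP => p0; move: h; rewrite p0; lra.
- move=> x; have [[i0 xi0]|nW] := pselect (exists i, W i (val x)); last first.
    rewrite (_ : [set _ | _] = set0) ?card_ge0//.
    rewrite -subset0 => _ [[i _ <-] xi]; apply: nW; by exists i.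
  pose S := [set i | `[< W i (val x) >]]%SET.
  (* All members of [S] lie above the one with the least value, so there are at most [m + 1] of
     them. *)
  have [i iS imin] : exists2 i, i \in S & forall j, j \in S ->
    psi i (val x) <= psi j (val x).
    have i0S : i0 \in S by rewrite inE; exact/asboolP.
    by case: (@arg_minP _ _ _ i0 (fun j => j \in S) (fun j =>
      psi j (val x)) i0S) => i iS imin;
      exists i.
  have cS : (#|S| <= m.+1)%N.
    have /asboolP[_] : `[< W i (val x) >] by move: iS; rewrite inE.
    apply: leq_trans; apply: subset_leq_card; apply/fintype.subsetP => j jS.
    by rewrite inE; exact: imin.
  apply: (@card_le_trans _ _ _ [set i | i \in S]).
    apply: card_le_trans (card_image_le (fun i => val @^-1` W i : set A) _).
    apply: subset_card_le => _ [[i1 _ <-] xi1]; exists i1 => //=.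
    by rewrite inE; exact/asboolP.
  apply: (@card_le_inj _ _ _ _ (fun i => index i (enum S))) =>
    [j /= jS|j j' /= jS jS'].
    by apply: leq_trans cS; rewrite cardE index_mem mem_enum.
  move=> /(congr1 (nth i (enum S))); rewrite !nth_index ?mem_enum//.
Qed.

(** The sets that avoid one side of each pair cover [A]; the members of a refinement of order
    [m + 1] are sent to vectors in general position in the corresponding orthants. The vectors
    occurring at a point are independent, so the combination [h] has no zero on [A]. Its coordinates
    have the signs that the pairs require, and the sets where they are away from 0 enlarge the pairs
    so that they cover [A]. *)
Lemma covering_dim_avoided (A : set X) : closed A ->
  covering_dim_le A m -> avoided (@sep_avoidance X B m hX cX oB baseB) A.
Proof.
move=> cA dA; apply: avoidedW => c.
pose side (sg : {ffun 'I_m.+1 -> bool}) : set X :=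
  \bigcap_i ~` closure (if sg i then sep_right c i else sep_left c i).
have oside sg : open (side sg).
  rewrite /side -setC_bigcup; apply: closed_openC.
  apply: closed_bigcup => [|i _]; first exact: finite_finset.
  exact: closed_closure.
have [||D [Dfin [Do DT] Dref Dord]] := dA (range (fun sg =>
  val @^-1` side sg : set A)).
- by apply: finite_image; exact: finite_finset.
- split; first by move=> _ [sg _ <-]; exists (side sg).
  apply/seteqP; split=> // x _.
  pose sg := [ffun i => `[< ~ closure (sep_right c i) (val x) >]] : {ffun
    'I_m.+1 -> bool}.
  exists (val @^-1` side sg); [by exists sg|move=> i _ /=; rewrite ffunE].
  case: asboolP => // /contrapT xr xl.
  by suff : set0 (val x) by []; rewrite -(sep_disjoint c i).
have [n [U [UD DU Uinj]]] := finite_enumeration Dfin.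
have /choice[V VP] i : exists V : set X, (i < n)%N ->
  open V /\ val @^-1` V = U i.
  have [ilt|] := boolP (i < n)%N; last by exists setT.
  by have [V oV VU] := open_set_typeP (Do _ (UD i ilt)); exists V.
have /choice[sg sgP] k : exists sg, (k < n)%N ->
  U k `<=` (val @^-1` side sg : set A).
  have [klt|] := boolP (k < n)%N; last by exists [ffun=> true].
  by have [_ [sg _ <-] ?] := Dref _ (UD k klt); exists sg.
have [||phi [cphi phi01 phiV phi1]] := @subordinate_functions A n V cA.
- by move=> i /VP[].
- move=> x Ax; pose x' : A := SigSub (mem_set Ax).
  have : (\bigcup_(W in D) W) x' by rewrite DT.
  move=> [W /DU[i ilt <-] Ux]; exists i => //.
  by have [_ VU] := VP i ilt; move: Ux; rewrite -VU.
have phiU k x (Ax : A x) : (k < n)%N -> phi k x != 0 ->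
  U k (SigSub (mem_set Ax)).
  by move=> klt /(phiV _ _ klt) Vx; have [_ <-] := VP k klt.
have [w [wsg wli]] := general_position R (fun k => sg k) n.
pose h i x := \sum_(k < n) phi k x * w k i.
have ch i : continuous (h i).
  apply: continuous_sumr => k x; apply: cvgM; first exact: cphi.
  exact: cvg_cst.
have phi_ge0 k x : 0 <= phi k x by have /andP[] := phi01 k x.
have hl x i : A x -> closure (sep_left c i) x -> 0 < h i x.
  move=> Ax xl; have wpos k : (k < n)%N -> phi k x != 0 -> 0 < w k i.
    move=> klt nz; have /= := sgP k klt _ (phiU k x Ax klt nz) i I.
    by have := wsg k i; case: (sg k i) => // _ [].
  have [k klt phik] := phi1 x Ax.
  rewrite /h (bigD1 (Ordinal klt))//= phik mul1r ltr_pwDl//.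
    by apply: wpos; rewrite ?phik ?oner_eq0.
  apply: sumr_ge0 => j _; have [->|nz] := eqVneq (phi j x) 0;
    first by rewrite mul0r.
  by rewrite mulr_ge0 ?phi_ge0// ltW// wpos.
have hr x i : A x -> closure (sep_right c i) x -> h i x < 0.
  move=> Ax xr; have wneg k : (k < n)%N -> phi k x != 0 -> w k i < 0.
    move=> klt nz; have /= := sgP k klt _ (phiU k x Ax klt nz) i I.
    by have := wsg k i; case: (sg k i) => // _ [].
  have [k klt phik] := phi1 x Ax.
  rewrite /h (bigD1 (Ordinal klt))//= phik mul1r -oppr_gt0 opprD ltr_pwDl//.
    by rewrite oppr_gt0; apply: wneg; rewrite ?phik ?oner_eq0.
  rewrite oppr_ge0; apply: sumr_le0 => j _.
  have [->|nz] := eqVneq (phi j x) 0; first by rewrite mul0r.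
  by rewrite mulr_ge0_le0 ?phi_ge0// ltW// wneg.
have hn0 x : A x -> exists i, h i x != 0.
  move=> Ax; apply: contrapT => nh.
  have h0 i : h i x = 0 by apply: contrapT => /eqP ?; apply: nh; exists i.
  pose S := [set k : 'I_n | phi k x != 0]%SET.
  have cS : (#|S| <= m.+1)%N.
    rewrite -card_le_II; pose x' : A := SigSub (mem_set Ax).
    apply: card_le_trans (Dord x').
    apply: (@card_le_trans _ _ _ [set k : 'I_n | k \in S]).
      apply/card_le_relP; exists (fun i k => i = index k (enum S)); split.
        move=> i /= iS; exists (enum_val (Ordinal iS)); first exact: enum_valP.
        by rewrite /enum_val index_uniq ?enum_uniq// -cardE.
      by move=> i i' k _ _ -> ->.
    apply: (@card_le_inj _ _ _ _ (fun k : 'I_n => U k)) =>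
      [k /=|k k' /= kS k'S UU].
      by rewrite inE => nz; split; [exact: UD|exact: phiU].
    by apply: val_inj; exact: Uinj (ltn_ord k) (ltn_ord k') UU.
  have [k klt phik] := phi1 x Ax.
  have : phi k x = 0.
    apply: (wli S cS (fun k => phi k x) _ (Ordinal klt)).
      move=> i; rewrite -[RHS](h0 i) /h big_mkcond /=; apply: eq_bigr => j _.
      by rewrite inE; case: eqP => [->|//]; rewrite mul0r.
    by rewrite inE /= phik oner_eq0.
  by rewrite phik => /eqP; rewrite oner_eq0.
have [d d0 dP] := compact_margin cA ch hn0.
have cAh i : closed (A `&` [set x | d <= h i x]).
  by apply: closedI => //; exact: closed_superlevel.
have cAh' i : closed (A `&` [set x | h i x <= - d]).
  by apply: closedI => //; exact: closed_sublevel.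
have [|||c' c'P] := @sep_exists X B m hX cX oB baseB
  (fun i => closure (sep_left c i) `|` (A `&` [set x | d <= h i x]))
  (fun i => closure (sep_right c i) `|` (A `&` [set x | h i x <= - d])).
- by move=> i; apply: closedU => //; exact: closed_closure.
- by move=> i; apply: closedU => //; exact: closed_closure.
- move=> i; rewrite -subset0 => x [[xl|[Ax xd]] [xr|[Ax' xd']]].
  + by suff : set0 x by []; rewrite -(sep_disjoint c i).
  + by have := hl _ _ Ax' xl; move: xd' => /=; lra.
  + by have := hr _ _ Ax xr; move: xd => /=; lra.
  + by move: xd xd' => /=; lra.
exists c'.
  by move=> i; split; [apply: subset_trans (c'P i).1|apply: subset_trans (c'P
    i).2];
    move=> x xc; left; exact: subset_closure.
rewrite -subset0 => x [Ax xc'].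
have [i] := dP x Ax; rewrite ler_normr => /orP[hd|hd].
  apply: (xc' i I); left; apply: subset_closure; apply: (c'P i).1; right.
  by split.
apply: (xc' i I); right; apply: subset_closure; apply: (c'P i).2; right.
by split=> //=; lra.
Qed.

End dimension.

(** * The theorem *)

Section sum_avoidance.
Context {X : topologicalType} (S T : avoidance X).

(** Conditions from different summands are incomparable, so the sum represents the intersection of
    the two families. *)
Definition sum_below (c c' : cond S + cond T) : Prop :=
  match c, c' with
  | inl c, inl c' => below c c'
  | inr c, inr c' => below c c'
  | _, _ => False
  end.

Definition sum_region (c : cond S + cond T) : set X :=
  match c with inl c => region c | inr c => region c end.

Lemma sum_below_refl c : sum_below c c.
Proof. by case: c => c; exact: below_refl. Qed.

Lemma sum_below_trans b a c : sum_below a b -> sum_below b c -> sum_below a c.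
Proof. by move: a b c => [a|a] [b|b] [c|c] //=; exact: below_trans. Qed.

Lemma sum_regionS c c' : sum_below c' c -> sum_region c' `<=` sum_region c.
Proof. by move: c c' => [c|c] [c'|c'] //=; exact: regionS. Qed.

Lemma sum_region_open c : open (sum_region c).
Proof. by case: c => c; exact: region_open. Qed.

Lemma sum_region_shrink c :
  exists2 c', sum_below c' c & closure (sum_region c') `<=` sum_region c.
Proof.
by case: c => c; have [c' c'c cc'] := region_shrink c;
  [exists (inl c')|exists (inr c')].
Qed.

Definition sum_avoidance : avoidance X :=
  @Avoidance X (cond S + cond T)%type sum_below sum_region sum_below_refl
    sum_below_trans sum_regionS sum_region_open sum_region_shrink.

Lemma sum_avoidedP A : avoided sum_avoidance A <-> avoided S A /\ avoided T A.
Proof.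
split=> [aA|[aS aT] [c|c]].
- split=> c.
    by have [[c'|c'] // cc Ac] := aA (inl c); exists c'.
  by have [[c'|c'] // cc Ac] := aA (inr c); exists c'.
- by have [c' cc Ac] := aS c; exists (inl c').
- by have [c' cc Ac] := aT c; exists (inr c').
Qed.

Lemma sum_spread : spread S -> spread T -> spread sum_avoidance.
Proof.
move=> sS sT [c|c].
  by have [s [sb sd]] := sS c; exists (fun k => inl (s k)).
by have [s [sb sd]] := sT c; exists (fun k => inr (s k)).
Qed.

Lemma sum_thin : thin S -> thin sum_avoidance.
Proof. by move=> tS A [cA /sum_avoidedP[aS _]]; exact: tS. Qed.

End sum_avoidance.

Lemma zset_dim_avoidance (R : realType) (n m : le_omega) :
  exists S : avoidance (hilbert_cube R), [/\ spread S, thin S &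
    closed_avoided S = @Zset R (hilbert_cube R) n `&` @closed_dim_le
      (hilbert_cube R) m].
Proof.
have [BY [_ oBY baseBY]] := @cube_countable_base R n.
have [BX [_ oBX baseBX]] := @cube_countable_base R Omega.
have [hY cY] := (@cube_hausdorff R n, @cube_compact R n).
have [hX cX] := (@cube_hausdorff R Omega, @cube_compact R Omega).
have t0 : @unit_interval R 0%R by rewrite /unit_interval /= in_itv /= lexx
  ler01.
have Y0 : [set: cube R n] !=set0 by exists (fun=> SigSub (mem_set t0)).
pose S := @zset_avoidance _ _ BY BX cY hX cX oBX baseBX.
have sS : spread S by exact: zset_spread.
have tS : thin S by exact: zset_thin.
have SP A : closed_avoided S A <-> @Zset R (hilbert_cube R) n A.
  split=> -[cA aA]; split=> //.
    exact: (zset_avoidedP hY cY oBY baseBY hX cX oBX baseBX cA).1.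
  exact: (zset_avoidedP hY cY oBY baseBY hX cX oBX baseBX cA).2.
case: m => [m|]; last first.
  by exists S; split=> //; apply/seteqP; split=> A => [/SP[cA aA]|[/SP]].
pose T := @sep_avoidance _ BX m hX cX oBX baseBX.
have sT : spread T by exact: (@sep_spread R).
exists (sum_avoidance S T); split; [exact: sum_spread|exact: sum_thin|].
apply/seteqP; split=> A.
  move=> [cA /sum_avoidedP[aS aT]]; split; first exact/SP.
  by split=> //; exact: (@avoided_covering_dim R _ BX m hX cX oBX baseBX).
move=> [/SP[cA aS] [_ dA]]; split=> //; apply/sum_avoidedP; split=> //.
exact: (@covering_dim_avoided R).
Qed.


Theorem corollary1p12 (R : realType) (n m : le_omega) :
  let X := hilbert_cube R in
  let I : set (set X) :=
    sigma_generated (@Zset R X n `&` @closed_dim_le X m) in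
  let M : set (set X) := @meager X in
  [/\ sigma_star_ideal I,
      exists2 k : set (set X), is_add I k & is_add M k,
      exists2 k : set (set X), is_cov I k & is_cov M k,
      exists2 k : set X, is_non I k & is_non M k &
      exists2 k : set (set X), is_cof I k & is_cof M k].
Proof.
move=> X I M.
have [S [sS tS SE]] := zset_dim_avoidance R n m.
have [B [B0 oB baseB]] := @cube_countable_base R Omega.
have [hX cX] := (@cube_hausdorff R Omega, @cube_compact R Omega).
have t0 : @unit_interval R 0 by rewrite /unit_interval /= in_itv /= lexx ler01.
pose x0 : X := fun=> SigSub (mem_set t0).
have IE : I = avoidance_ideal S by rewrite /I -SE.
have ME : M = avoidance_ideal (base_avoidance hX cX oB baseB x0) by exact: meager_base.
have gI : governed I.
  by rewrite IE; exact: (avoidance_governed hX cX B0 oB baseB x0).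
have gM : governed M.
  rewrite ME; apply: (avoidance_governed hX cX B0 oB baseB x0).
    exact: base_spread.
  by move=> A [cA /base_avoidedP]; apply.
have [add cov non cof] := governed_cardinals gI gM.
split=> //.
by rewrite IE; exact: avoidance_ideal_sigma_star.
Qed.
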